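(* For $n\ge2$ let $$Q_n(w)=\tfrac12u(0,n)+\sum_{1\le m<n}u(m,n)w^m.$$ As $n\to\infty$, the roots of $Q_n(w)$ tend to equidistribution on the unit circle.
   Context: A (weakly) unimodal sequence of size $n$ is a finite sequence of positive integers $a_1,\dots,a_s$ with a distinguished index $k$ (the peak, indicated by an overline) such that $a_1\le a_2\le\cdots\le a_{k-1}\le\overline{a}_k\ge a_{k+1}\ge\cdots\ge a_s$ and $\sum_{j=1}^sa_j=n$. If the largest part is repeated, sequences with different choices of peak are counted as different. The rank of a unimodal sequence is the number of parts to the right of the peak minus the number of parts before the peak. $u(m,n)$ is the number of unimodal sequences of size $n$ with rank $m$; equivalently, the generating function is $$\sum_{n\ge0}\sum_{m\in\mathbb{Z}}u(m,n)w^mq^n=\sum_{n\ge0}\frac{q^n}{(wq;q)_n(w^{-1}q;q)_n},\qquad (a;q)_n=\prod_{k=0}^{n-1}(1-aq^k).$$ For a polynomial $f$ of degree $d\ge1$ with roots $z_1,\dots,z_d\in\mathbb{C}$ listed with multiplicity, let $\mu_{\{f\}}=\frac1d\sum_{j=1}^d\delta_{z_j}$, where $\delta_z$ is the Dirac measure at $z$. The roots of a sequence of polynomials $f_n$ tend to equidistribution on the unit circle as $n\to\infty$ if $\mu_{\{f_n\}}$ converges weakly, as measures on $\mathbb{C}$, to the normalized Haar (uniform probability) measure on $\{|z|=1\}$. *)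

(* Defs.v *)
From HB Require Import structures.
From mathcomp Require Import all_boot all_order all_algebra.
From mathcomp Require Import all_classical all_reals all_analysis.
From mathcomp Require Import measurable_realfun complex.
Set Implicit Arguments.
Unset Strict Implicit.
Unset Printing Implicit Defensive.
Import Order.TTheory GRing.Theory Num.Theory.
Import numFieldNormedType.Exports.
Local Open Scope classical_set_scope.
Local Open Scope ring_scope.

(* [unimodal a k]: the list [a] with peak at the 0-based index [k]. *)
Definition unimodal (a : seq nat) (k : nat) : bool :=
  [&& (k < size a)%N, all (leq 1) a,
      sorted leq (take k.+1 a) & sorted geq (drop k a)].

Definition unimodal_rank (a : seq nat) (k : nat) : int :=
  (size (drop k.+1 a))%:Z - (size (take k a))%:Z.

(* Bounding the length and the parts by the size loses nothing, which lets
   [u] be a cardinality over a finite type. *)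
Lemma unimodal_bounded (a : seq nat) (k n : nat) :
  unimodal a k -> sumn a = n -> (size a <= n)%N /\ all (fun x => x <= n)%N a.
Proof.
move=> /and4P[_ a_gt0 _ _] <-; elim: a a_gt0 => //= x a IH /andP[x_gt0 a_gt0].
have [IHs IHa] := IH a_gt0; split; first by rewrite -add1n leq_add.
rewrite leq_addr; apply/allP => y /(allP IHa) ya.
exact: leq_trans ya (leq_addl _ _).
Qed.

Definition u (m : int) (n : nat) : nat :=
  (\sum_(s < n.+1)
     #|[pred x : s.-tuple 'I_n.+1 * 'I_s |
         let a : seq nat := map val x.1 in
         [&& unimodal a x.2, sumn a == n & unimodal_rank a x.2 == m]]|)%N.

(* Meaningful for [2 <= n]; the values at [n < 2] do not affect limits. *)
Definition Q (R : realType) (n : nat) : {poly R[i]} :=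
  (2^-1 * (u 0 n)%:R)%:P + \sum_(1 <= m < n) (u m%:Z n)%:R *: 'X^m.

(* [T] with its Borel sigma-algebra. *)
Notation borel T := (g_sigma_algebraType (@open T)).

Definition weak_cvg (R : realType) (T : ptopologicalType)
    (mu : nat -> {measure set (borel T) -> \bar R})
    (nu : {measure set (borel T) -> \bar R}) : Prop :=
  forall f : T -> R, continuous f -> (exists M, forall x, `|f x| <= M) ->
    (fun n => \int[mu n]_(x in [set: borel T]) f x) @ \oo -->
    (\int[nu]_(x in [set: borel T]) f x : R).

(* [R[i]^o] is [R[i]] with the topology of its modulus. *)
Notation borelC R := (borel (complex R)^o).

(* The roots listed with multiplicity (there are [(size p).-1] if [p != 0]). *)
Definition roots_of (R : realType) (p : {poly R[i]}) : seq R[i] :=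
  sval (closed_field_poly_normal p).

Definition root_measure (R : realType) (p : {poly R[i]}) :
    {measure set (borelC R) -> \bar R} :=
  let d := size (roots_of p) in
  mscale (d%:R^-1)%:nng (msum (fun j => \d_((roots_of p)`_j : borelC R)) d).

Definition expi (R : realType) (t : measurableTypeR R) : borelC R :=
  (cos t +i* sin t)%C.

Lemma continuous_expi (R : realType) : continuous (@expi R : R -> R[i]^o).
Proof.
have cC : continuous (fun x : R => (x%:C)%C : R[i]^o).
  move=> x; apply/cvgrPdist_lt => e; rewrite ltcE /= => /andP[/eqP e0 e_gt0].
  near=> y; rewrite -rmorphB normc_def /= expr0n addr0 sqrtr_sqr.
  rewrite ltcE /= -e0 eqxx /=.
  by near: y; move/cvgrPdist_lt: (@cvg_id _ (nbhs x)) => /(_ _ e_gt0).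
have -> : (@expi R : R -> R[i]^o) =
    (fun t => (cos t)%:C%C + 'i%C * (sin t)%:C%C : R[i]^o).
  by apply/funext => t; rewrite /expi [LHS]complexE.
move=> t; apply: cvgD.
  exact: continuous_comp (@continuous_cos R t) (cC _).
by apply: cvgMl_tmp; exact: continuous_comp (@continuous_sin R t) (cC _).
Unshelve. all: by end_near. Qed.

Lemma measurable_expi (R : realType) :
  measurable_fun [set: measurableTypeR R] (@expi R).
Proof.
apply: (@measurability _ _ _ (borelC R) setT (@expi R) (@open R[i]^o)) => //.
move=> _ [A oA <-]; rewrite setTI; apply: open_measurable.
by move/continuousP: (@continuous_expi R); apply.
Qed.
HB.instance Definition _ (R : realType) :=
  isMeasurableFun.Build _ _ _ _ (@expi R) (@measurable_expi R).

Lemma lt0_2pi (R : realType) : 0 < pi *+ 2 :> R.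
Proof. by rewrite mulrn_wgt0// pi_gt0. Qed.

(* The law of [expi t] for [t] uniform on [0, 2 pi]. *)
Definition haar_circle (R : realType) : probability (borelC R) R :=
  distribution (uniform_prob (lt0_2pi R)) (@expi R).

Definition roots_equidistribute (R : realType) (f : nat -> {poly R[i]}) : Prop :=
  weak_cvg (fun n => root_measure (f n)) (haar_circle R).

(* Main.v *)
Require Import Defs.
From mathcomp Require Import all_boot all_order all_algebra.
From mathcomp Require Import all_classical all_reals all_analysis.
From mathcomp Require Import complex.
From mathcomp Require Import cyclic separable measurable_realfun.
From mathcomp Require cyclotomic.
From mathcomp Require Import ring lra zify.
Set Implicit Arguments.
Unset Strict Implicit.
Unset Printing Implicit Defensive.
Import Order.TTheory GRing.Theory Num.Theory.
Import numFieldNormedType.Exports.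
Import Normc.
Local Notation Re := complex.Re.
Local Open Scope classical_set_scope.
Local Open Scope ring_scope.

(** Erdos-Turan type argument.  If [P] has degree [d] and extreme coefficients
    [a], [b], its roots are equidistributed as soon as
    [log (|P|_2^2 / |a b|) = o(d)].  Here the extreme coefficients of [Q n] are
    at least [1/2], and [u m n] is at most [(n+1)^(4T+2)] for any [T^2 > n], so
    that the logarithm is [O(sqrt n log n)].
    - Radially: replacing the factor [X - z] by [1 - z^* X] preserves the
      [L^2] norm of the coefficients (Landau), which bounds the product of the
      moduli of any set of roots, hence the number of roots away from the circle.
    - Angularly: dividing each root by its modulus does not increase the
      normalized [L^2] norm (Schur), so [H = prod (X - w_j)], [|w_j| = 1], is at
      most [e^o(d)] on the disc of radius [1/2], where it has no zero and
      [|H 0| = 1].  By the Borel-Caratheodory inequality the Taylor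
      coefficients of [log H], which are the power sums of the [w_j] up to
      conjugation, are [o(d)].
    - Continuous functions on the circle are uniform limits of real parts of
      polynomials, and power sums are all that is needed to average those. *)

(** * Square norms of polynomials, with the inequalities of Landau and Schur *)

Definition sqnorm (C : numClosedFieldType) (p : {poly C}) : C :=
  \sum_(i < size p) `|p`_i| ^+ 2.

(** The Fourier coefficient of index -1 of [|p|^2] on the unit circle. The last term vanishes, its
    second factor being read past the end of [p]. *)
Definition autocor (C : numClosedFieldType) (p : {poly C}) : C :=
  \sum_(i < size p) p`_i * (p`_i.+1)^*.

Section SquareNorm.
Variable C : numClosedFieldType.
Implicit Types (p G : {poly C}) (a b c : C) (rs : seq C).

Lemma sqnorm_widen p n : (size p <= n)%N ->
  sqnorm p = \sum_(i < n) `|p`_i| ^+ 2.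
Proof.
move=> le_pn; rewrite /sqnorm (big_ord_widen _ (fun i => `|p`_i| ^+ 2) le_pn).
rewrite big_mkcond /=; apply: eq_bigr => i _; case: ltnP => // le_pi.
by rewrite nth_default // normr0 expr0n.
Qed.

Lemma sqnorm_ge0 p : 0 <= sqnorm p.
Proof. by apply: sumr_ge0 => i _; rewrite exprn_ge0. Qed.

Lemma sqnorm_coef p i : `|p`_i| ^+ 2 <= sqnorm p.
Proof.
case: (ltnP i (size p)) => [lt_ip | le_pi]; last first.
  by rewrite nth_default // normr0 expr0n sqnorm_ge0.
rewrite /sqnorm (bigD1 (Ordinal lt_ip)) //= lerDl.
by apply: sumr_ge0 => j _; rewrite exprn_ge0.
Qed.

Lemma size_lin b c : (size (b *: 'X + c%:P)%R <= 2)%N.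
Proof.
rewrite (leq_trans (size_polyD _ _)) // geq_max.
rewrite (leq_trans (size_scale_leq _ _)) ?size_polyX //=.
exact: leq_trans (size_polyC_leq1 _) _.
Qed.

(** Squaring the coefficients [b p_(i-1) + c p_i] yields two multiples of the norm and a cross term.
    A linear factor thus matters only through [|b|^2 + |c|^2] and [b c^*]. *)
Lemma sqnorm_lin b c p :
  sqnorm ((b *: 'X + c%:P) * p) =
  (`|b| ^+ 2 + `|c| ^+ 2) * sqnorm p
  + (b * c^* * autocor p + (b * c^* * autocor p)^*).
Proof.
pose n := size p.
have size_le : (size ((b *: 'X + c%:P)%R * p)%R <= n.+1)%N.
  apply: leq_trans (size_polyMleq _ _) _.
  by rewrite -subn1 leq_subLR add1n -add2n leq_add2r size_lin.
have coefE i : ((b *: 'X + c%:P) * p)`_i = b * (if i is j.+1 then p`_j else 0) + c * p`_i.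
  by rewrite mulrDl coefD -scalerAl coefZ coefXM coefCM; case: i.
rewrite (sqnorm_widen size_le) big_ord_recl coefE mulr0 add0r.
under eq_bigr => i _ do rewrite coefE /=.
have E (x y : C) : `|x + y| ^+ 2 = `|x| ^+ 2 + `|y| ^+ 2 + (x * y^* + (x * y^*)^*).
  by rewrite !normCK rmorphD rmorphM /= conjCK; ring.
under eq_bigr => i _ do rewrite E.
rewrite big_split big_split /= -/n.
have -> : \sum_(i < n) `|b * p`_i| ^+ 2 = `|b| ^+ 2 * sqnorm p.
  by rewrite mulr_sumr; apply: eq_bigr => i _; rewrite normrM exprMn.
have -> : \sum_(i < n) (b * p`_i * (c * p`_(bump 0 i))^* + (b * p`_i * (c * p`_(bump 0 i))^*)^*)
  = b * c^* * autocor p + (b * c^* * autocor p)^*.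
  rewrite big_split /=.
  have -> : \sum_(i < n) (b * p`_i * (c * p`_(bump 0 i))^*) = b * c^* * autocor p.
    by rewrite mulr_sumr; apply: eq_bigr => i _; rewrite rmorphM /=; ring.
  rewrite -rmorph_sum /=; congr (_ + (_)^*).
  by rewrite mulr_sumr; apply: eq_bigr => i _; rewrite rmorphM /=; ring.
rewrite addrA [X in X + _ = _]addrA; congr (_ + _).
rewrite mulrDl [LHS]addrAC [LHS]addrC; congr (_ + _).
have -> : \sum_(i < n) `|c * p`_(bump 0 i)| ^+ 2 = \sum_(i < n) `|c * p`_i.+1| ^+ 2 by [].
rewrite -(big_ord_recl n (fun i => `|c * p`_i| ^+ 2)).
rewrite (@sqnorm_widen p n.+1) // mulr_sumr.
by apply: eq_bigr => i _; rewrite normrM exprMn.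
Qed.

(** Both linear factors have the same [|b|^2 + |c|^2], and [b c^* = - a^*] for both. *)
Lemma sqnorm_reflect a p :
  sqnorm (((- a^*) *: 'X + 1%:P) * p) = sqnorm (('X - a%:P) * p).
Proof.
have -> : 'X - a%:P = 1 *: 'X + (- a)%:P by rewrite scale1r polyCN.
rewrite !sqnorm_lin !normrN norm_conjC normr1 !rmorphN /= conjC1; ring.
Qed.

(* Replacing a factor [X - z] by [1 - z^* X] preserves the square norm; after
   doing so for all [z] in [S], the leading coefficient has modulus
   [prod_(z in S) |z|]. *)
Lemma landau_prod rs (S : pred C) :
  \prod_(z <- rs | S z) `|z| ^+ 2 <= sqnorm (\prod_(z <- rs) ('X - z%:P)).
Proof.
pose fl z : {poly C} := if S z then (- z^*) *: 'X + 1%:P else 'X - z%:P.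
(* [G] collects the factors already treated, so that the induction reflects one factor at a time. *)
have E : forall G, sqnorm (\prod_(z <- rs) ('X - z%:P) * G) = sqnorm (\prod_(z <- rs) fl z * G).
  elim: rs => [|z rs IH] G; first by rewrite !big_nil.
  rewrite !big_cons -!mulrA mulrCA IH mulrCA /fl.
  by case: (S z); rewrite // sqnorm_reflect.
have szfl z : (size (fl z) <= 2)%N.
  by rewrite /fl; case: (S z); rewrite ?size_lin // size_XsubC.
(* The coefficient of degree [size rs] need not be the leading one: reflecting the root [0] gives a
   constant factor, and then both sides vanish. *)
have top : (\prod_(z <- rs) fl z)`_(size rs) = \prod_(z <- rs) (fl z)`_1 /\
    (size (\prod_(z <- rs) fl z)%R <= (size rs).+1)%N.
  elim: rs {E} => [|z rs [IH IHs]]; first by rewrite !big_nil coef1 size_poly1.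
  rewrite !big_cons; split; last first.
    apply: leq_trans (size_polyMleq _ _) _.
    by rewrite -subn1 leq_subLR -[leqRHS]/(2 + (size rs).+1)%N leq_add.
  rewrite coefM (bigD1 (inord 1)) //= inordK // subSS subn0 IH.
  rewrite [X in _ + X]big1 ?addr0 // => -[[|[|i]] lti] /=.
  - by rewrite [X in _ * X]nth_default ?mulr0.
  - by rewrite -(inj_eq val_inj) /= inordK.
  - by rewrite nth_default ?mul0r // (leq_trans (szfl z)).
rewrite -[X in sqnorm X]mulr1 E mulr1.
apply: le_trans (sqnorm_coef _ (size rs)); rewrite top.1 normr_prod -prodrXl big_mkcond /=.
apply: ler_prod => z _; rewrite /fl; case: (S z).
  by rewrite exprn_ge0 // coefD coefZ coefX coefC mulr1 addr0 normrN norm_conjC /=.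
by rewrite ler01 coefB coefX coefC subr0 normr1 expr1n /=.
Qed.

(* For each factor, what is lost is [(1 - |z|)^2] times a square norm. *)
Lemma schur_prod rs :
  \prod_(z <- rs) `|z| * sqnorm (\prod_(z <- rs) ('X - (z / `|z|)%:P)) <=
  sqnorm (\prod_(z <- rs) ('X - z%:P)).
Proof.
suff E G : \prod_(z <- rs) `|z| * sqnorm (\prod_(z <- rs) ('X - (z / `|z|)%:P) * G) <=
    sqnorm (\prod_(z <- rs) ('X - z%:P) * G).
  by have := E 1; rewrite !mulr1.
elim: rs G => [|z rs IH] G; first by rewrite !big_nil !mul1r.
rewrite !big_cons -!mulrA [in leRHS]mulrCA.
apply: le_trans (IH _); rewrite [in leRHS]mulrCA [in leLHS]mulrCA.
apply: ler_wpM2l; first by apply: prodr_ge0.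
set H := _ * G.
have lin a : 'X - a%:P = 1 *: 'X + (- a)%:P :> {poly C} by rewrite scale1r polyCN.
have [->|z0] := eqVneq z 0; first by rewrite normr0 mul0r sqnorm_ge0.
have nz0 : `|z| != 0 by rewrite normr_eq0.
rewrite !lin !sqnorm_lin !normrN normr1 normrM normfV normr_id divff // !mul1r expr1n.
have -> : (- (z / `|z|))^* = (- z^*) / `|z|.
  by rewrite rmorphN fmorph_div /= conj_normC mulNr.
rewrite mulrDr [in leRHS]rmorphN /=.
(* The factor [|z|] makes the two cross terms equal, so that only [2 |z| <= 1 + |z|^2] is left. *)
set k := autocor H.
have -> : `|z| * (- z^* / `|z| * k + (- z^* / `|z| * k)^*) = - z^* * k + (- z^* * k)^*.
  by rewrite !rmorphM fmorphV /= conj_normC; field.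
rewrite lerD2r mulrA; apply: ler_wpM2r; first exact: sqnorm_ge0.
rewrite -subr_ge0.
have -> : 1 + `|z| ^+ 2 - `|z| * (1 + 1) = (`|z| - 1) ^+ 2 by ring.
by rewrite real_exprn_even_ge0 // realB ?normr_real ?real1.
Qed.

End SquareNorm.

(** * The modulus as a real number, and the logarithm of [|1 - z|] *)

Section Modulus.
Variable R : realType.
Implicit Types (z w : R[i]) (x : R).

Lemma normr_normc z : `|z| = (normc z)%:C%C.
Proof. by case: z => a b; rewrite normc_def. Qed.

Lemma normc_ge0 z : 0 <= normc z.
Proof. by rewrite -ler0c -normr_normc. Qed.

Lemma normc_sqr z : normc z ^+ 2 = Re z ^+ 2 + complex.Im z ^+ 2.
Proof. by case: z => a b /=; rewrite sqr_sqrtr // addr_ge0 ?sqr_ge0. Qed.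

Lemma normc_real x : normc x%:C%C = `|x|.
Proof. by rewrite /= expr0n addr0 sqrtr_sqr. Qed.

Lemma normcX z n : normc (z ^+ n) = normc z ^+ n.
Proof. by elim: n => [|n IH]; rewrite ?normc1 // !exprS normcM IH. Qed.

Lemma normc_prod (I : Type) (r : seq I) (P : pred I) (F : I -> R[i]) :
  normc (\prod_(i <- r | P i) F i) = \prod_(i <- r | P i) normc (F i).
Proof. exact: (big_morph _ (@normcM R) (@normc1 R)). Qed.

Lemma normc_conj z : normc z^*%C = normc z.
Proof. by case: z => a b /=; rewrite sqrrN. Qed.

Lemma normc_eq0 z : (normc z == 0) = (z == 0).
Proof. by apply/eqP/eqP => [/eq0_normc|->] //; rewrite normc0. Qed.

Lemma ReD z w : Re (z + w) = Re z + Re w.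
Proof. by case: z; case: w. Qed.

Lemma ReN z : Re (- z) = - Re z.
Proof. by case: z. Qed.

Lemma Re_sum (I : Type) (r : seq I) (P : pred I) (F : I -> R[i]) :
  Re (\sum_(i <- r | P i) F i) = \sum_(i <- r | P i) Re (F i).
Proof. exact: (big_morph _ ReD (erefl _)). Qed.

Lemma ReZ x z : Re (x%:C%C * z) = x * Re z.
Proof. by case: z => a b /=; rewrite mul0r subr0. Qed.

Lemma Re_le_normc z : `|Re z| <= normc z.
Proof. by rewrite -lecR -normr_normc normc_ge_Re. Qed.

Lemma Re_mul z w : Re z * Re w = 2^-1 * (Re (z * w) + Re (z * w^*%C)).
Proof. by case: z w => [a b] [c d] /=; field. Qed.

(* The Taylor remainder of [s |-> ln |1 - s z|] on [0, 1] is controlled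
   through its derivative [Re (- z (s z)^K / (1 - s z))]. *)
Lemma ln_normc_taylor z K : normc z <= 2^-1 ->
  `| ln (normc (1 - z)) + \sum_(m < K) Re (z ^+ m.+1) / m.+1%:R | <= 2^-1 ^+ K.
Proof.
move=> z_le.
(* [pp] is [|1 - s z|^2], a polynomial in the real variable [s]; hence the factor [2^-1] in front of
   its logarithm below. *)
pose pp : {poly R} := (normc z ^+ 2) *: 'X^2 - (2 * Re z) *: 'X + 1.
pose q : {poly R} := \sum_(m < K) (Re (z ^+ m.+1) / m.+1%:R) *: 'X^(m.+1).
have ppE s : pp.[s] = normc (1 - s%:C%C * z) ^+ 2.
  rewrite normc_sqr /pp !hornerE normc_sqr; case: (z) => a b /=; ring.
have sz_le (s : R) : s \in `[0, 1]%R -> normc (s%:C%C * z) <= 2^-1.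
  rewrite in_itv /= => /andP[s0 s1]; rewrite normcM normc_real ger0_norm //.
  by rewrite -[leRHS]mul1r ler_pM // normc_ge0.
have dist_ge (s : R) : s \in `[0, 1]%R -> 2^-1 <= normc (1 - s%:C%C * z).
  move=> /sz_le h; have := le_normcD (1 - s%:C%C * z) (s%:C%C * z).
  rewrite subrK normc1; lra.
have pp_gt0 (s : R) : s \in `[0, 1]%R -> 0 < pp.[s].
  by move=> /dist_ge h; rewrite ppE exprn_gt0 // (lt_le_trans _ h).
pose g s := 2^-1 * ln pp.[s] + q.[s].
pose dg s := 2^-1 * (pp.[s]^-1 * pp^`().[s]) + q^`().[s].
have dgE (s : R) : s \in `[0, 1]%R -> is_derive s 1 g (dg s).
  move=> s01.
  have := is_derive1_ln (pp_gt0 _ s01) => h1.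
  have h2 : is_derive s (1 : R) (fun t => ln pp.[t]) (pp.[s]^-1 * pp^`().[s]).
    exact: (@is_derive1_comp R (@ln R) (horner pp) s _ _ h1 (is_derive_poly pp s)).
  have h3 : is_derive s (1 : R) (fun t => 2^-1 * ln pp.[t]) (2^-1 * (pp.[s]^-1 * pp^`().[s])).
    exact: is_deriveZ.
  exact: is_deriveD.
have dg_le (s : R) : s \in `[0, 1]%R -> `|dg s| <= 2^-1 ^+ K.
  move=> s01; have := dist_ge _ s01; have := sz_le _ s01 => h1 h2.
  have nz : 1 - s%:C%C * z != 0.
    by rewrite -normc_eq0 gt_eqF // (lt_le_trans _ h2).
  have -> : dg s = Re (- (z * (s%:C%C * z) ^+ K / (1 - s%:C%C * z))).
    have -> : - (z * (s%:C%C * z) ^+ K / (1 - s%:C%C * z)) =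
       - z / (1 - s%:C%C * z) + \sum_(m < K) (s ^+ m)%:C%C * z ^+ m.+1.
      (* The derivative of the Taylor sum is geometric; its closed form merges with
         [- z / (1 - s z)] into a single term. *)
      have := subrX1 (s%:C%C * z) K; set S := \sum_(i < K) _ => hS.
      have -> : \sum_(m < K) (s ^+ m)%:C%C * z ^+ m.+1 = z * S.
        rewrite mulr_sumr; apply: eq_bigr => m _.
        by rewrite rmorphXn /= exprMn exprS mulrCA.
      have -> : (s%:C%C * z) ^+ K = (s%:C%C * z - 1) * S + 1 by rewrite -hS subrK.
      by field.
    rewrite ReD Re_sum /dg; congr (_ + _).
      rewrite ppE normc_sqr /pp !poly.derivE !hornerE normc_sqr.
      have : normc (1 - s%:C%C * z) ^+ 2 != 0 by rewrite sqrf_eq0 normc_eq0.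
      rewrite normc_sqr; case: (z) => a b /= h; field.
      by move: h; congr (_ != _); rewrite /=; ring.
    rewrite /q linear_sum horner_sum; apply: eq_bigr => m _.
    have aux (c x : R) n : c / n.+1%:R * (x *+ n.+1) = x * c.
      by rewrite -[x *+ _]mulr_natr mulrA mulrAC divfK ?pnatr_eq0 // mulrC.
    by rewrite /= poly.derivZ derivXn hornerZ hornerMn hornerXn ReZ aux.
  apply: le_trans (Re_le_normc _) _; rewrite normcN !normcM normcV normcX.
  (* Here [|z| <= 1/2 <= |1 - s z|] disposes of the denominator. *)
  rewrite ler_pdivrMr ?(lt_le_trans _ h2) // mulrC.
  apply: ler_pM; rewrite ?exprn_ge0 ?normc_ge0 //.
    by apply: lerXn2r => //; rewrite nnegrE ?normc_ge0.
  exact: le_trans h2.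
have cont : {within `[0 : R, 1], continuous g}.
  by apply: derivable_within_continuous => s s01; apply: ex_derive; exact: dgE.
have der (s : R) : s \in `]0, 1[%R -> is_derive s 1 g (dg s).
  by move=> s01; apply: dgE; apply: subset_itv_oo_cc.
have [c c01] := MVT_segment ler01 der cont.
rewrite subr0 mulr1 => E; have := dg_le _ c01; rewrite -E.
congr (`| _ | <= _); rewrite /g !ppE.
have -> : q.[0] = 0.
  by rewrite horner_sum big1 // => m _; rewrite hornerZ hornerXn expr0n mulr0.
rewrite rmorph0 mul0r subr0 normc1 expr1n ln1 mulr0 addr0 subr0 rmorph1 mul1r.
congr (_ + _); last by rewrite horner_sum; apply: eq_bigr => m _;
  rewrite hornerZ hornerXn expr1n mulr1.
have := dist_ge 1; rewrite bound_in_itv bnd_simp /= ler01 rmorph1 mul1r => /(_ isT) h.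
by rewrite lnXn ?(lt_le_trans _ h) // -[ln _ *+ 2]mulr_natl mulKf ?pnatr_eq0.
Qed.

End Modulus.

(** * Averages over roots of unity *)

(** In characteristic 0 the polynomial [X^n - 1] is separable, and [n] distinct [n]-th roots of
    unity include a primitive one. *)
Lemma prim_root_exists (C : numClosedFieldType) n :
  (n > 0)%N -> {z : C | n.-primitive_root z}.
Proof.
move=> n0; apply/sigW; have [rs] := closed_field_poly_normal ('X^n - 1 : {poly C}).
rewrite (monicP _) ?monicXnsubC // scale1r => Drs.
have rs_unity : all n.-unity_root rs.
  by apply/allP => z zrs; rewrite /root_of_unity Drs root_prod_XsubC.
have rs_uniq : uniq rs.
  by rewrite -separable_prod_XsubC -Drs cyclotomic.separable_Xn_sub_1 // pnatr_eq0 -lt0n.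
have rs_size : (n <= size rs)%N.
  by have := size_XnsubC (1 : C) n0; rewrite Drs size_prod_XsubC => -[->].
by have /hasP[z _ zP] := has_prim_root n0 rs_unity rs_uniq rs_size; exists z.
Qed.

Lemma sum_expr_root1 (F : fieldType) (x : F) n :
  x ^+ n = 1 -> x != 1 -> \sum_(l < n) x ^+ l = 0.
Proof.
move=> xn1 x1; apply/eqP; have := subrX1 x n; rewrite xn1 subrr => /esym/eqP.
by rewrite mulf_eq0 subr_eq0 (negPf x1).
Qed.

Section PowerSums.
Variable R : realType.
Implicit Types (z w c : R[i]).

Lemma normc1_conj z : normc z = 1 -> z * z^*%C = 1.
Proof. by move=> h; rewrite -sqr_normc normr_normc h expr1n. Qed.

Lemma normc_prim_root n z : (0 < n)%N -> n.-primitive_root z -> normc z = 1.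
Proof.
move=> n0 /prim_expr_order /(congr1 (@normc R)); rewrite normcX normc1 => /eqP.
by rewrite pexpr_eq1 ?normc_ge0 // => /eqP.
Qed.

(** Orthogonality of characters. Sums over the [n]-th roots of unity replace integrals over the
    circle, without error for frequencies below [n]. *)
Lemma sum_prim_root_conj n z a b : (a < n)%N -> (b < n)%N -> n.-primitive_root z ->
  \sum_(l < n) z ^+ (l * a) * (z^*%C) ^+ (l * b) = if a == b then n%:R else 0.
Proof.
move=> an bn zP; have n0 : (0 < n)%N by exact: leq_ltn_trans an.
have nz := normc_prim_root n0 zP; have zJ := normc1_conj nz.
have z0 : z != 0 by rewrite -normc_eq0 nz oner_eq0.
have -> : z^*%C = z^-1 by apply: (mulfI z0); rewrite zJ divff.
have E l : z ^+ (l * a) * z^-1 ^+ (l * b) = (z ^+ a / z ^+ b) ^+ l.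
  by rewrite exprMn exprVn exprVn -!exprM mulnC [(b * l)%N]mulnC.
under eq_bigr => l _ do rewrite E.
have [<-|neq] := eqVneq a b.
  rewrite divff ?expf_neq0 //; under eq_bigr => l _ do rewrite expr1n.
  by rewrite sumr_const card_ord.
apply: sum_expr_root1.
  by rewrite exprMn exprVn -!exprM !(mulnC _ n) !exprM (prim_expr_order zP) !expr1n divff ?oner_eq0.
apply: contra neq => /eqP /(congr1 (fun x => x * z ^+ b)).
rewrite mulfVK ?expf_neq0 // mul1r => /eqP.
by rewrite (eq_prim_root_expr zP) !modn_small.
Qed.

Lemma sum_prim_root n z a : (0 < a < n)%N -> n.-primitive_root z ->
  \sum_(l < n) z ^+ (l * a) = 0.
Proof.
move=> /andP[a0 an] zP; have := sum_prim_root_conj an (leq_ltn_trans (leq0n _) an) zP.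
rewrite (negPf (lt0n_neq0 a0)) => h; rewrite -[RHS]h.
by apply: eq_bigr => l _; rewrite muln0 mulr1.
Qed.

Lemma conjcM z w : (z * w)^*%C = z^*%C * w^*%C.
Proof. exact: rmorphM. Qed.

Lemma conjcX z n : (z ^+ n)^*%C = z^*%C ^+ n.
Proof. exact: rmorphXn. Qed.

Lemma Re_conjc z : Re z^*%C = Re z.
Proof. by case: z. Qed.

Lemma fejer_weight_ge0 c z l k : normc c = 1 -> normc z = 1 ->
  0 <= 1 + Re (c * z ^+ (l * k)).
Proof.
move=> c1 z1; have := Re_le_normc (c * z ^+ (l * k)).
by rewrite normcM normcX z1 expr1n c1 mulr1 ler_norml; lra.
Qed.

Lemma fejer_weight_sum c z n k : (0 < k < n)%N -> n.-primitive_root z ->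
  \sum_(l < n) (1 + Re (c * z ^+ (l * k))) = n%:R.
Proof.
move=> kn zP; rewrite big_split /= sumr_const card_ord -Re_sum -mulr_sumr.
by rewrite sum_prim_root // mulr0 addr0.
Qed.

(** The Taylor expansion of the logarithm has no constant term, so the weight isolates its term of
    frequency [k]. Truncation after [K] terms costs [2^-K], and [K + k < n] prevents aliasing. *)
Lemma fejer_average w c k K n z :
  normc w = 1 -> normc c = 1 -> (0 < k <= K)%N -> (K + k < n)%N -> n.-primitive_root z ->
  n%:R * (- (Re (c * w ^+ k) / (k%:R * 2 ^+ k.+1)) - 2^-1 ^+ K) <=
  \sum_(l < n) (1 + Re (c * z ^+ (l * k))) * ln (normc (1 - z ^+ l / 2 * w^*%C)).
Proof.
move=> w1 c1 /andP[k0 kK] Kn zP.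
have n0 : (0 < n)%N by exact: leq_ltn_trans Kn.
have nz := normc_prim_root n0 zP; have zJ := normc1_conj nz.
have om_ge0 l := fejer_weight_ge0 l k c1 nz.
have sumom : \sum_(l < n) (1 + Re (c * z ^+ (l * k))) = n%:R.
  by apply: fejer_weight_sum => //; rewrite k0 (leq_ltn_trans _ Kn) // leq_addl.
have half : 2^-1 = (2^-1)%:C%C :> R[i] by rewrite fmorphV rmorph_nat.
pose v m : R[i] := (w^*%C / 2) ^+ m.
(* [Re_mul] produces the frequencies [k + m.+1], which averages to 0, and [k - m.+1], which survives
   only if [m.+1 = k]. The power [2 ^+ k.+1] combines the radius [1/2] with the factor [1/2] of
   [Re_mul]. *)
have T (m : 'I_K) : \sum_(l < n) (1 + Re (c * z ^+ (l * k))) * Re ((z ^+ l / 2 * w^*%C) ^+ m.+1) =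
   if m.+1 == k then n%:R * (Re (c * w ^+ k) / 2 ^+ k.+1) else 0.
  have mn : (m.+1 < n)%N by rewrite (leq_ltn_trans _ Kn) // (leq_trans (ltn_ord m)) // leq_addr.
  have kn : (k < n)%N by rewrite (leq_ltn_trans _ Kn) // leq_addl.
  have mkn : (k + m.+1 < n)%N by rewrite (leq_ltn_trans _ Kn) // addnC leq_add2r ltn_ord.
  have E l : (z ^+ l / 2 * w^*%C) ^+ m.+1 = z ^+ (l * m.+1) * v m.+1.
    by rewrite /v -mulrA exprMn [2^-1 * _]mulrC exprM.
  under eq_bigr => l _ do rewrite E mulrDl mul1r Re_mul.
  rewrite big_split /= -Re_sum -mulr_suml.
  rewrite sum_prim_root // mul0r add0r -mulr_sumr big_split /= -!Re_sum.
  have -> : \sum_(l < n) c * z ^+ (l * k) * (z ^+ (l * m.+1) * v m.+1) =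
      c * v m.+1 * \sum_(l < n) z ^+ (l * (k + m.+1)).
    by rewrite mulr_sumr; apply: eq_bigr => l _; rewrite mulnDr exprD;
      move: (z ^+ _) (z ^+ _) => x y; ring.
  rewrite sum_prim_root ?mkn ?addnS // mulr0.
  have -> : \sum_(l < n) c * z ^+ (l * k) * (z ^+ (l * m.+1) * v m.+1)^*%C =
      c * (v m.+1)^*%C * (if k == m.+1 then n%:R else 0).
    rewrite -(sum_prim_root_conj kn mn zP) mulr_sumr; apply: eq_bigr => l _.
    by rewrite conjcM conjcX; ring.
  rewrite [k == _]eq_sym add0r; case: eqP => [->|_]; last by rewrite mulr0 mulr0.
  have -> : (v k)^*%C = (2^-1 ^+ k)%:C%C * w ^+ k.
    rewrite /v half conjcX conjcM conjcK conjc_real.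
    by rewrite (rmorphXn (real_complex R)) mulrC exprMn.
  have -> : c * ((2^-1 ^+ k)%:C%C * w ^+ k) * n%:R = (2^-1 ^+ k * n%:R)%:C%C * (c * w ^+ k).
    by rewrite rmorphM rmorph_nat; ring.
  by rewrite ReZ exprVn exprS; field; rewrite expf_neq0.
apply: (@le_trans _ _ (\sum_(l < n) (1 + Re (c * z ^+ (l * k))) *
   (- (\sum_(m < K) Re ((z ^+ l / 2 * w^*%C) ^+ m.+1) / m.+1%:R) - 2^-1 ^+ K))); last first.
  apply: ler_sum => l _; apply: ler_wpM2l => //.
  have := @ln_normc_taylor R (z ^+ l / 2 * w^*%C) K.
  rewrite !normcM normc_conj w1 normcX nz expr1n mul1r mulr1 normcV.
  rewrite -[2 : R[i]](rmorph_nat (real_complex R)) normc_real ger0_norm // => /(_ (lexx _)).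
  by rewrite ler_norml => /andP[h _]; lra.
under eq_bigr => l _ do rewrite mulrBr.
rewrite sumrB -mulr_suml sumom mulrBr lerD2r le_eqVlt; apply/orP; left; apply/eqP.
under [RHS]eq_bigr => l _ do rewrite mulrN mulr_sumr.
rewrite sumrN exchange_big /=.
have -> : \sum_(j < K) \sum_(i < n)
      (1 + Re (c * z ^+ (i * k))) * (Re ((z ^+ i / 2 * w^*%C) ^+ j.+1) / j.+1%:R)
  = \sum_(j < K) (if j.+1 == k then n%:R * (Re (c * w ^+ k) / 2 ^+ k.+1) else 0) / j.+1%:R.
  by apply: eq_bigr => j _; rewrite -T mulr_suml; apply: eq_bigr => i _; rewrite mulrA.
have kP : (k.-1 < K)%N by rewrite prednK.
rewrite (bigD1 (Ordinal kP)) //= prednK // eqxx big1 ?addr0 => [|j jk].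
  by rewrite mulrN -mulrA -mulrA invfM [k%:R^-1 * _]mulrC.
case: eqP => [jk1|]; last by rewrite mul0r.
by move: jk; rewrite -(inj_eq val_inj) /= -jk1 eqxx.
Qed.

End PowerSums.

(** * Bounding the power sums of points on the circle *)

Lemma geometric_halves_le2 (R : realType) n : \sum_(i < n) 2^-1 ^+ i <= 2 :> R.
Proof.
have -> : \sum_(i < n) 2^-1 ^+ i = 2 - 2 * 2^-1 ^+ n :> R.
  elim: n => [|n IH]; first by rewrite big_ord0 expr0; lra.
  by rewrite big_ord_recr IH /= exprS; field.
by rewrite gerBl mulr_ge0 // exprn_ge0 // invr_ge0.
Qed.

(** Removes the truncation error of the Taylor expansions without passing to a limit; it rests on
    [N <= 2^N]. *)
Lemma le_addgeo (R : realType) (x y a : R) k :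
  (forall K, (k <= K)%N -> x <= y + a * 2^-1 ^+ K) -> x <= y.
Proof.
move=> h; apply/ler_addgt0Pr => e e0.
have [a0|a0] := leP a 0.
  apply: le_trans (h k (leqnn _)) _; rewrite lerD2l (le_trans _ (ltW e0)) //.
  by rewrite mulr_le0_ge0 // exprn_ge0 // invr_ge0.
have [N aN] : exists N : nat, a / e < N%:R.
  by exists (Num.truncn (a / e)).+1; rewrite truncnS_gt.
apply: le_trans (h (k + N)%N (leq_addr _ _)) _; rewrite lerD2l.
rewrite exprVn ler_pdivrMr ?exprn_gt0 // mulrC -ler_pdivrMr //.
apply: le_trans (ltW aN) _; rewrite -natrX ler_nat.
exact: leq_trans (ltnW (ltn_expl N (leqnn 2))) (leq_pexp2l _ (leq_addl _ _)).
Qed.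

Section PowerSumBound.
Variable R : realType.
Implicit Types (z w c : R[i]).

Lemma normc_sum (I : Type) (r : seq I) (P : pred I) (F : I -> R[i]) :
  normc (\sum_(i <- r | P i) F i) <= \sum_(i <- r | P i) normc (F i).
Proof.
elim/big_rec2 : _ => [|i x y _ h]; first by rewrite normc0.
by apply: le_trans (le_normcD _ _) _; rewrite lerD2l.
Qed.

Lemma ln_prod (I : Type) (r : seq I) (P : pred I) (F : I -> R) :
  (forall i, P i -> 0 < F i) ->
  ln (\prod_(i <- r | P i) F i) = \sum_(i <- r | P i) ln (F i).
Proof.
move=> F0; elim: r => [|i r IH]; first by rewrite !big_nil ln1.
rewrite !big_cons; case: ifP => // Pi; rewrite lnM ?IH // posrE ?F0 //.
exact: prodr_gt0.
Qed.

Lemma normc_horner_half (p : {poly R[i]}) (B : R) z : 0 <= B ->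
  (forall i, normc p`_i <= B) -> normc z <= 2^-1 -> normc p.[z] <= 2 * B.
Proof.
move=> B0 pB z_le; rewrite horner_coef (le_trans (normc_sum _ _ _)) //.
apply: (@le_trans _ _ (\sum_(i < size p) B * 2^-1 ^+ i)).
  apply: ler_sum => i _; rewrite normcM normcX ler_pM ?exprn_ge0 ?normc_ge0 //.
  by rewrite lerXn2r // nnegrE ?normc_ge0.
by rewrite -mulr_sumr mulrC ler_wpM2r // geometric_halves_le2.
Qed.

(* Averaging [ln |H|] over the circle of radius 1/2 against the nonnegative
   weight [1 + Re (c zeta^k)], as in the Borel-Caratheodory inequality. *)
Lemma power_sum_le (ws : seq R[i]) (B : R) k : (0 < k)%N ->
  (forall w, w \in ws -> normc w = 1) ->
  (forall i, normc (\prod_(w <- ws) ('X - w%:P))`_i <= B) ->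
  normc (\sum_(w <- ws) w ^+ k) <= k%:R * 2 ^+ k.+1 * ln (2 * B).
Proof.
move=> k0 ws1 HB; set H := \prod_(w <- ws) _ in HB *; set S := \sum_(w <- ws) _.
(* [H] is monic, so one of its coefficients is 1; in particular [ln (2 * B)] is nonnegative. *)
have B1 : 1 <= B.
  have := HB (size ws); have : lead_coef H = 1 by apply/monicP/monic_prod_XsubC.
  by rewrite lead_coefE size_prod_XsubC /= => ->; rewrite normc1.
have [->|S0] := eqVneq S 0.
  by rewrite normc0 mulr_ge0 ?mulr_ge0 ?exprn_ge0 // ln_ge0 //; lra.
have nS0 : normc S != 0 by rewrite normc_eq0.
(* The rotation taking [S] to the negative real axis, so that [- Re (c * S)] is [|S|]. *)
pose c : R[i] := - (S^*%C / (normc S)%:C%C).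
have c1 : normc c = 1.
  by rewrite normcN normcM normcV normc_conj normc_real ger0_norm ?normc_ge0 // divff.
have cS : Re (c * S) = - normc S.
  have -> : c * S = (- normc S)%:C%C.
    rewrite /c mulNr mulrAC [S^*%C * S]mulrC -sqr_normc normr_normc rmorphN /= expr2 mulfK //.
    by rewrite -normc_eq0 normc_real normr_eq0.
  by [].
have k2 : 0 < k%:R * 2 ^+ k.+1 :> R by rewrite mulr_gt0 ?exprn_gt0 ?ltr0n.
rewrite mulrC -ler_pdivrMr //.
apply: (@le_addgeo R _ _ (size ws)%:R k) => K kK.
pose n := (K + k).+1; have [z zP] := prim_root_exists R[i] (ltn0Sn (K + k)).
have z1 := normc_prim_root (ltn0Sn _) zP.
have kn : (0 < k < n)%N by rewrite k0 ltnS leq_addl.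
have n0 : 0 < n%:R :> R by rewrite ltr0n.
have zl l : normc (z ^+ l / 2) = 2^-1.
  rewrite normcM normcX z1 expr1n mul1r normcV.
  by rewrite -[2 : R[i]](rmorph_nat (real_complex R)) normc_real ger0_norm.
(* As [|w| = 1], the factors [|1 - u w^*|] and [|u - w|] agree, and the logarithms add up to
   [ln |H u|]. *)
have dist w l : w \in ws -> normc (1 - z ^+ l / 2 * w^*%C) = normc (z ^+ l / 2 - w).
  move=> /ws1 w1; have -> : 1 - z ^+ l / 2 * w^*%C = - (w^*%C * (z ^+ l / 2 - w)).
    by rewrite mulrBr [w^*%C * w]mulrC normc1_conj //; ring.
  by rewrite normcN normcM normc_conj w1 mul1r.
have pos w l : w \in ws -> 0 < normc (z ^+ l / 2 - w).
  move=> /ws1 w1; have := le_normcD (z ^+ l / 2 - w) (- (z ^+ l / 2)).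
  by rewrite addrAC subrr add0r !normcN w1 zl; lra.
have lnH l : \sum_(w <- ws) ln (normc (1 - z ^+ l / 2 * w^*%C)) <= ln (2 * B).
  have -> : \sum_(w <- ws) ln (normc (1 - z ^+ l / 2 * w^*%C)) = ln (normc H.[z ^+ l / 2]).
    rewrite horner_prod normc_prod big_seq [in RHS]big_seq ln_prod => [|w wws].
      by apply: eq_bigr => w wws; rewrite dist // hornerXsubC.
    by rewrite hornerXsubC pos.
  have h : normc H.[z ^+ l / 2] <= 2 * B.
    by apply: normc_horner_half => //; [lra | rewrite zl].
  rewrite ler_ln // posrE; last lra.
  rewrite horner_prod normc_prod big_seq prodr_gt0 // => w wws.
  by rewrite hornerXsubC pos.
have : \sum_(w <- ws) n%:R * (- (Re (c * w ^+ k) / (k%:R * 2 ^+ k.+1)) - 2^-1 ^+ K) <=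
       \sum_(l < n) (1 + Re (c * z ^+ (l * k))) * ln (2 * B).
  apply: (@le_trans _ _ (\sum_(w <- ws) \sum_(l < n)
     (1 + Re (c * z ^+ (l * k))) * ln (normc (1 - z ^+ l / 2 * w^*%C)))).
    rewrite big_seq [leRHS]big_seq; apply: ler_sum => w wws.
    by apply: fejer_average => //; rewrite ?k0 // ws1.
  rewrite exchange_big; apply: ler_sum => l _; rewrite -mulr_sumr ler_wpM2l //.
  exact: fejer_weight_ge0.
rewrite -mulr_suml fejer_weight_sum // -mulr_sumr ler_pM2l // sumrB sumrN -mulr_suml.
rewrite -Re_sum -mulr_sumr cS big_const_seq count_predT iter_addr_0 mulNr opprK.
by rewrite lerBlDr [(size ws)%:R * _]mulr_natl.
Qed.

End PowerSumBound.

(** * Approximation on the circle by real parts of polynomials *)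

(** Bounds the normalizing constant of the kernel from below. The induction uses
    [(m+1) C(2m+2, m+1) = 2 (2m+1) C(2m, m)]. *)
Lemma central_bin_ge m : (4 ^ m <= (2 * m).+1 * 'C(2 * m, m))%N.
Proof.
elim: m => [|m IH]; first by rewrite bin0.
have e1 : (m.+1 * 'C((2 * m).+1, m.+1) = (2 * m).+1 * 'C(2 * m, m))%N.
  by rewrite -mul_bin_diag.
have e2 : (m.+1 * 'C(2 * m.+1, m.+1) = 2 * m.+1 * 'C((2 * m).+1, m.+1))%N.
  have -> : 'C((2 * m).+1, m.+1) = 'C((2 * m).+1, m).
    by rewrite -[RHS]bin_sub; [congr binomial; lia|lia].
  by rewrite mulnS add2n -mul_bin_diag.
rewrite expnS; apply: (@leq_trans (4 * (m.+1 * 'C((2 * m).+1, m.+1)))%N).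
  by rewrite leq_pmul2l // e1.
have -> : (4 * (m.+1 * 'C((2 * m).+1, m.+1)) = 2 * (m.+1 * 'C(2 * m.+1, m.+1)))%N.
  by rewrite e2; lia.
by rewrite mulnA leq_mul2r; apply/orP; right; lia.
Qed.

(** With truncated subtraction, [m - j + (j - m)] is the distance between [j] and [m], the frequency
    of the [j]-th term of the kernel. *)
Lemma natdist_ltS j m : (j < (2 * m).+1)%N -> (m - j + (j - m) < m.+1)%N.
Proof. lia. Qed.

Lemma natdist_neq0 j m : j != m -> (0 == m - j + (j - m))%N = false.
Proof. lia. Qed.

(** For [q = 1 / (1 + t)], squaring Bernoulli's inequality gives [(1 + t)^(2 k) >= (k t)^2], which
    outgrows a linear factor. *)
Lemma linear_geometric_small (R : realType) (q e : R) : 0 <= q -> q < 1 -> 0 < e ->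
  exists m, (2 * m).+1%:R * q ^+ m <= e.
Proof.
rewrite le_eqVlt => /orP[/eqP <- _ e0|q0 q1 e0].
  by exists 1%N; rewrite expr1 mulr0 ltW.
pose t := q^-1 - 1; have t0 : 0 < t by rewrite subr_gt0 invf_gt1.
have qE : q = (1 + t)^-1 by rewrite addrC subrK invrK.
have bern k : 1 + k%:R * t <= (1 + t) ^+ k.
  elim: k => [|k IH]; first by rewrite mul0r addr0 expr0.
  rewrite exprS; apply: (@le_trans _ _ ((1 + t) * (1 + k%:R * t))).
    rewrite -natr1 -subr_ge0.
    have -> : (1 + t) * (1 + k%:R * t) - (1 + (k%:R + 1) * t) = k%:R * t ^+ 2 by ring.
    by rewrite mulr_ge0 // exprn_ge0 // ltW.
  by rewrite ler_wpM2l //; lra.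
(* The witness is [m = 2 k], for which the linear factor is [4 k + 1 <= 5 k]. *)
pose k := (Num.truncn (5 / (e * t ^+ 2))).+1.
have k_gt : 5 / (e * t ^+ 2) < k%:R by rewrite truncnS_gt.
have k1 : 1 <= k%:R :> R by rewrite ler1n.
exists (k * 2)%N; rewrite exprM qE !exprVn.
have kt : 0 < (k%:R * t) ^+ 2 by rewrite exprn_gt0 // mulr_gt0 // ltr0n.
rewrite ler_pdivrMr; last by rewrite exprn_gt0 // exprn_gt0 //; lra.
apply: (@le_trans _ _ (e * (k%:R * t) ^+ 2)).
  have : 5 <= k%:R * (e * t ^+ 2).
    by rewrite -ler_pdivrMr ?mulr_gt0 ?exprn_gt0 // ltW.
  move=> h; apply: (@le_trans _ _ (5 * k%:R)).
    by rewrite -[X in X.+1](mulnC _ 2%N) -natr1 !natrM; lra.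
  have -> : e * (k%:R * t) ^+ 2 = (k%:R * (e * t ^+ 2)) * k%:R by ring.
  by rewrite ler_wpM2r.
apply: ler_wpM2l; first exact: ltW.
have h1 : k%:R * t <= (1 + t) ^+ k by apply: le_trans (bern k); rewrite lerDr.
have h0 : 0 <= k%:R * t by rewrite mulr_ge0 // ltW.
by apply: lerXn2r => //; rewrite nnegrE // (le_trans h0).
Qed.

Section CircleApproximation.
Variable R : realType.
Implicit Types (z w c : R[i]).

(** On the circle [|w + z|^2 = (w + z)^2 w^* z^*], to whose power the binomial formula applies. The
    terms with [j > m] are conjugated, which leaves their real part unchanged. *)
Lemma normcD_expand m w z : normc w = 1 -> normc z = 1 ->
  normc (w + z) ^+ (2 * m) =
  \sum_(j < (2 * m).+1) 'C(2 * m, j)%:R * Re ((w * z^*%C) ^+ (m - j + (j - m))).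
Proof.
move=> /normc1_conj ww /normc1_conj zz.
have -> : normc (w + z) ^+ (2 * m) = Re (((w + z) * (w + z)^*%C) ^+ m).
  by rewrite -sqr_normc normr_normc -exprM -(rmorphXn (real_complex R)).
have -> : (w + z) * (w + z)^*%C = (w + z) ^+ 2 * (w^*%C * z^*%C).
  have -> : (w + z)^*%C = w^*%C + z^*%C by exact: rmorphD.
  rewrite expr2 -mulrA; congr (_ * _).
  by rewrite mulrDl mulrA ww mulrCA zz; ring.
rewrite exprMn -exprM exprDn mulr_suml Re_sum; apply: eq_bigr => j _.
have pull (x y : R[i]) k : Re (x *+ k * y) = k%:R * Re (x * y).
  rewrite [x *+ k * y]mulrnAl; elim: k => [|k IH]; first by rewrite mul0r.
  by rewrite [x * y *+ _]mulrSr ReD IH -natr1 mulrDl mul1r.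
rewrite pull; congr (_ * _); have j2 : (j <= 2 * m)%N by rewrite -ltnS.
have split_w a b : w ^+ (a + b) * w^*%C ^+ b = w ^+ a.
  by rewrite exprD -mulrA -exprMn ww expr1n mulr1.
have split_z a b : z ^+ a * z^*%C ^+ (a + b) = z^*%C ^+ b.
  by rewrite exprD mulrA -exprMn zz expr1n mul1r.
have split_w' a b : w ^+ a * w^*%C ^+ (a + b) = w^*%C ^+ b.
  by rewrite exprD mulrA -exprMn ww expr1n mul1r.
have split_z' a b : z ^+ (a + b) * z^*%C ^+ a = z ^+ b.
  by rewrite addnC exprD -mulrA -exprMn zz expr1n mulr1.
case: (leqP j m) => [jm|/ltnW mj].
  have -> : (j - m = 0)%N by lia.
  rewrite addn0 !exprMn; congr Re.
  have -> : (2 * m - j = (m - j) + m)%N by lia.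
  by rewrite mulrACA split_w -[in RHS](split_z j) subnKC.
have -> : (m - j = 0)%N by lia.
rewrite add0n -[in RHS]Re_conjc conjcX conjcM conjcK !exprMn; congr Re.
have -> : w ^+ (2 * m - j) * z ^+ j * (w^*%C ^+ m * z^*%C ^+ m) =
   (w ^+ (2 * m - j) * w^*%C ^+ m) * (z ^+ j * z^*%C ^+ m) by ring.
congr (_ * _).
  have := split_w' (2 * m - j)%N (j - m)%N.
  by have -> : (2 * m - j + (j - m) = m)%N by lia.
by have := split_z' m (j - m)%N; rewrite subnKC.
Qed.

(** The parallelogram law; it makes the kernel small away from its peak [w = z]. *)
Lemma normcD_sqr w z : normc w = 1 -> normc z = 1 ->
  normc (w + z) ^+ 2 = 4 - normc (w - z) ^+ 2.
Proof.
move=> /(congr1 (fun x => x ^+ 2)) + /(congr1 (fun x => x ^+ 2)).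
rewrite !normc_sqr !expr1n; case: w z => [a b] [c d] /=; nra.
Qed.

(* [f] is averaged against the de la Vallee Poussin kernel
   [|w + z|^(2 m) / 'C(2 m, m)] over the roots of unity [z]. *)
Lemma circle_approx (f : R[i] -> R) (M : R) :
  (forall w, normc w = 1 -> `|f w| <= M) ->
  (forall e, 0 < e -> exists2 d, 0 < d & forall w z, normc w = 1 -> normc z = 1 ->
     normc (w - z) < d -> `|f w - f z| <= e) ->
  forall e, 0 < e -> exists p : {poly R[i]}, forall w, normc w = 1 ->
     `|f w - Re p.[w]| <= e.
Proof.
move=> fM fc e e0; have e20 : 0 < e / 2 by rewrite divr_gt0.
have [d' d'0 fd'] := fc _ e20; pose d := Num.min d' 1.
have d0 : 0 < d by rewrite lt_min d'0 ltr01.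
have d1 : d <= 1 by rewrite ge_min lexx orbT.
have fd w z : normc w = 1 -> normc z = 1 -> normc (w - z) < d -> `|f w - f z| <= e / 2.
  by move=> w1 z1 wz; apply: fd' => //; apply: lt_le_trans wz _; rewrite ge_min lexx.
have M0 : 0 <= M by apply: le_trans (fM 1 (normc1 _)).
(* By [normcD_sqr], [|w + z|^2 <= 4 q] as soon as [|w - z| >= d]. *)
pose q := 1 - d ^+ 2 / 4.
have d2 : d ^+ 2 <= 1 by rewrite expr_le1 // ltW.
have d20 : 0 < d ^+ 2 by rewrite exprn_gt0.
(* The oscillation of [f] is at most [2 M]; adding 1 avoids a division by 0 when [M = 0]. *)
have [m qm] : exists m, (2 * m).+1%:R * q ^+ m <= e / 2 / (2 * M + 1).
  by apply: linear_geometric_small; rewrite ?divr_gt0 // /q; lra.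
(* The frequencies of the kernel are at most [m], so [m.+1] nodes average it exactly. *)
pose n := m.+1; have [z zP] := prim_root_exists R[i] (ltn0Sn m).
have z1 := normc_prim_root (ltn0Sn _) zP.
have zl1 l : normc (z ^+ l) = 1 by rewrite normcX z1 expr1n.
have n0 : n%:R != 0 :> R by rewrite pnatr_eq0.
pose b : R := 'C(2 * m, m)%:R.
have b0 : 0 < b by rewrite ltr0n bin_gt0 leq_pmull.
pose ker w l : R := normc (w + z ^+ l) ^+ (2 * m) / b.
have ker0 w l : 0 <= ker w l by rewrite divr_ge0 ?exprn_ge0 ?normc_ge0 // ltW.
have kerE w l : normc w = 1 -> ker w l = b^-1 *
    \sum_(j < (2 * m).+1) 'C(2 * m, j)%:R * Re ((w * (z ^+ l)^*%C) ^+ (m - j + (j - m))).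
  by move=> w1; rewrite /ker normcD_expand // mulrC.
have kersum w : normc w = 1 -> \sum_(l < n) ker w l = n%:R.
  move=> w1; under eq_bigr => l _ do rewrite kerE //.
  rewrite -mulr_sumr exchange_big /=.
  have mP : (m < (2 * m).+1)%N by rewrite ltnS leq_pmull.
  rewrite (bigD1 (Ordinal mP)) //= [X in _ + X]big1 ?addr0 => [|j jm].
    under eq_bigr => l _ do rewrite subnn addn0 expr0 mulr1.
    by rewrite sumr_const card_ord mulrnAr mulVf ?gt_eqF.
  rewrite -mulr_sumr -Re_sum.
  have jm' : (j != m :> nat) by apply: contra jm => /eqP h; apply/eqP/val_inj.
  have bn := natdist_ltS (ltn_ord j).
  have -> : \sum_(l < n) (w * (z ^+ l)^*%C) ^+ (m - j + (j - m)) = 0.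
    have := sum_prim_root_conj (ltn0Sn m) bn zP; rewrite natdist_neq0 //.
    move=> h; rewrite -[RHS](mulr0 (w ^+ (m - j + (j - m)))) -[in RHS]h mulr_sumr.
    by apply: eq_bigr => l _; rewrite exprMn conjcX muln0 expr0 mul1r exprM.
  by rewrite mulr0.
have ker_far w l : normc w = 1 -> d <= normc (w - z ^+ l) -> ker w l <= e / 2 / (2 * M + 1).
  move=> w1 far; apply: le_trans qm; rewrite ler_pdivrMr // exprM normcD_sqr //.
  apply: (@le_trans _ _ ((4 * q) ^+ m)).
    have hd : d ^+ 2 <= normc (w - z ^+ l) ^+ 2 by rewrite lerXn2r ?nnegrE ?normc_ge0 // ltW.
    rewrite lerXn2r ?nnegrE //; first by rewrite -normcD_sqr // exprn_ge0 // normc_ge0.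
      by rewrite /q; lra.
    by rewrite /q; lra.
  rewrite exprMn mulrAC ler_wpM2r ?exprn_ge0 //; first by rewrite /q; lra.
  by rewrite /b -natrX -natrM ler_nat central_bin_ge.
exists (\sum_(l < n) \sum_(j < (2 * m).+1)
   ((n%:R^-1 * f (z ^+ l) * (b^-1 * 'C(2 * m, j)%:R))%:C%C *
    (z ^+ l)^*%C ^+ (m - j + (j - m))) *: 'X^(m - j + (j - m))) => w w1.
have -> : Re (\sum_(l < n) \sum_(j < (2 * m).+1)
   ((n%:R^-1 * f (z ^+ l) * (b^-1 * 'C(2 * m, j)%:R))%:C%C *
    (z ^+ l)^*%C ^+ (m - j + (j - m))) *: 'X^(m - j + (j - m))).[w] =
   n%:R^-1 * \sum_(l < n) f (z ^+ l) * ker w l.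
  rewrite horner_sum Re_sum mulr_sumr; apply: eq_bigr => l _.
  rewrite horner_sum Re_sum kerE // !mulr_sumr; apply: eq_bigr => j _.
  by rewrite hornerZ hornerXn -[_%:C%C * _ * _]mulrA ReZ -exprMn [w * _]mulrC !mulrA.
have -> : f w = n%:R^-1 * \sum_(l < n) f w * ker w l.
  by rewrite -mulr_sumr kersum // mulrCA mulVf // mulr1.
rewrite -mulrBr -sumrB normrM ger0_norm ?invr_ge0 // mulrC ler_pdivrMr ?ltr0n //.
apply: le_trans (ler_norm_sum _ _ _) _.
apply: (@le_trans _ _ (\sum_(l < n) (e / 2 * ker w l + e / 2))); last first.
  by rewrite big_split /= -mulr_sumr kersum // sumr_const card_ord -mulr_natr; lra.
(* Close nodes use the continuity of [f], far nodes the smallness of the kernel. *)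
apply: ler_sum => l _; rewrite -mulrBl normrM [X in _ * X]ger0_norm //.
have [close|far] := ltP (normc (w - z ^+ l)) d.
  apply: (@le_trans _ _ (e / 2 * ker w l)); last by rewrite lerDl ltW.
  by rewrite ler_wpM2r // fd.
apply: (@le_trans _ _ (e / 2)); last by rewrite lerDr mulr_ge0 // ltW.
apply: (@le_trans _ _ ((2 * M + 1) * (e / 2 / (2 * M + 1)))).
  apply: ler_pM => //; last exact: ker_far.
  apply: le_trans (ler_normB _ _) _.
  by have := fM w w1; have := fM _ (zl1 l); lra.
by rewrite mulrC divfK // gt_eqF //; lra.
Qed.

End CircleApproximation.

(** * Quantitative equidistribution under the Erdos-Turan condition *)

Section EquidistributionBound.
Variable R : realType.
Implicit Types (z w : R[i]) (rs : seq R[i]) (E : R).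

(* [radial 0 = 0]. *)
Definition radial z : R[i] := z / `|z|.

(* The Erdos-Turan condition [sqnorm P <= e^E |P`_0| |lead_coef P|] for the
   monic polynomial [P] with roots [rs]. *)
Definition flat_roots rs E : Prop :=
  sqnorm (\prod_(z <- rs) ('X - z%:P)) <= (expR E * \prod_(z <- rs) normc z)%:C%C.

Lemma landau_flat rs E (S : pred R[i]) : flat_roots rs E ->
  (\prod_(z <- rs | S z) normc z) ^+ 2 <= expR E * \prod_(z <- rs) normc z.
Proof.
move=> flat; rewrite -lecR; apply: le_trans flat; apply: le_trans (landau_prod rs S).
rewrite -prodrXl rmorph_prod le_eqVlt; apply/orP; left; apply/eqP.
by apply: eq_bigr => z _; rewrite normr_normc rmorphXn.
Qed.

Lemma flat_prod_ge rs E : flat_roots rs E -> expR (- E) <= \prod_(z <- rs) normc z.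
Proof.
move=> /(landau_flat pred0); rewrite big_pred0_eq expr1n expRN => h.
by rewrite -[leLHS]mulr1 ler_pdivrMl ?expR_gt0.
Qed.

(** Let [P] be the product of all the moduli. Landau's inequality for all roots gives [P <= e^E];
    for [S] it then bounds the square by [e^E P <= e^(2 E)]. *)
Lemma flat_prod_le rs E (S : pred R[i]) : flat_roots rs E ->
  \prod_(z <- rs | S z) normc z <= expR E.
Proof.
move=> flat; have P0 := lt_le_trans (expR_gt0 _) (flat_prod_ge flat).
have := landau_flat predT flat; rewrite expr2 ler_pM2r // => PE.
have := landau_flat S flat => h.
rewrite -(@ler_pXn2r _ 2) ?nnegrE ?expR_ge0 ?prodr_ge0 // => [|z _]; last exact: normc_ge0.
by apply: le_trans h _; rewrite [leRHS]expr2 ler_wpM2l ?expR_ge0.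
Qed.

Lemma flat_ge0 rs E : flat_roots rs E -> 0 <= E.
Proof.
move=> flat; have := le_trans (flat_prod_ge flat) (flat_prod_le predT flat).
by rewrite ler_expR; lra.
Qed.

Lemma flat_neq0 rs E z : flat_roots rs E -> z \in rs -> z != 0.
Proof.
move=> flat zrs; have := lt_le_trans (expR_gt0 _) (flat_prod_ge flat).
rewrite lt0r => /andP[+ _]; rewrite prodf_seq_neq0 => /allP /(_ _ zrs).
by rewrite normc_eq0.
Qed.

Lemma flat_count_out rs E (d : R) : 0 < d -> flat_roots rs E ->
  (count (fun z => 1 + d <= normc z) rs)%:R * ln (1 + d) <= E.
Proof.
move=> d0 flat; have := flat_prod_le (fun z => 1 + d <= normc z) flat.
move=> h; rewrite -ler_expR (le_trans _ h) // mulrC expRM_natr lnK ?posrE; last lra.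
rewrite -big_filter -size_filter.
have : all (fun z => 1 + d <= normc z) (seq.filter (fun z => 1 + d <= normc z) rs).
  exact: seq.filter_all.
elim: (seq.filter _ rs) => [|z s IH] /=; first by rewrite big_nil expr0.
move=> /andP[zd sd]; rewrite big_cons exprS; apply: ler_pM => //; last exact: IH.
  lra.
by rewrite exprn_ge0 //; lra.
Qed.

(** All the roots have product of moduli at least [e^(-E)], and those outside [S] at most [e^E].
    Those in [S] thus have product at least [e^(-2 E)], although each is at most [1 - d]. *)
Lemma flat_count_in rs E (d : R) : 0 < d -> d < 1 -> flat_roots rs E ->
  (count (fun z => normc z <= 1 - d) rs)%:R * - ln (1 - d) <= 2 * E.
Proof.
move=> d0 d1 flat; set S := fun z => normc z <= 1 - d.
have h1 := flat_prod_le (predC S) flat; have := flat_prod_ge flat.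
rewrite (bigID S) /= => h2.
have h3 : expR (- E) <= \prod_(i <- rs | S i) normc i * expR E.
  by apply: le_trans h2 _; rewrite ler_wpM2l // prodr_ge0 // => z _; exact: normc_ge0.
have h4 : expR (- (2 * E)) <= \prod_(i <- rs | S i) normc i.
  have -> : - (2 * E) = - E + - E by ring.
  by rewrite expRD [expR (- E)]expRN ler_pdivrMr ?expR_gt0 // -expRN.
have h5 : \prod_(i <- rs | S i) normc i <= (1 - d) ^+ count S rs.
  rewrite -big_filter -size_filter.
  have : all S (seq.filter S rs) by exact: seq.filter_all.
  elim: (seq.filter _ rs) => [|z s IH] /=; first by rewrite big_nil expr0.
  move=> /andP[zd sd]; rewrite big_cons exprS; apply: ler_pM => //; rewrite ?normc_ge0 ?IH //.
  by rewrite prodr_ge0 // => x _; exact: normc_ge0.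
rewrite mulrN lerNl -ler_expR (le_trans h4) // (le_trans h5) // mulrC expRM_natr.
by rewrite lnK // posrE; lra.
Qed.

Lemma normc_radial z : z != 0 -> normc (radial z) = 1.
Proof.
move=> z0; have nz : normc z != 0 by rewrite normc_eq0.
by rewrite /radial normcM normcV normr_normc normc_real ger0_norm ?normc_ge0 // divff.
Qed.

Lemma normc_sub_radial z : z != 0 -> normc (z - radial z) = `|normc z - 1|.
Proof.
move=> z0; have nz : (normc z)%:C%C != 0 :> R[i].
  by rewrite -normc_eq0 normc_real normr_eq0 normc_eq0.
have -> : z - radial z = (normc z - 1)%:C%C * radial z.
  rewrite /radial normr_normc rmorphB rmorph1 mulrBl mul1r; congr (_ - _).
  by rewrite mulrCA divff // mulr1.
by rewrite normcM normc_real normc_radial // mulr1.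
Qed.

(** In Schur's inequality the product of the moduli cancels against that of [flat_roots], so
    [power_sum_le] applies to the projected roots with [B = e^E]. *)
Lemma flat_power_sum rs E k : (0 < k)%N -> flat_roots rs E ->
  normc (\sum_(z <- rs) radial z ^+ k) <= k%:R * 2 ^+ k.+1 * (1 + E).
Proof.
move=> k0 flat; have P0 := lt_le_trans (expR_gt0 _) (flat_prod_ge flat).
have E0 := flat_ge0 flat.
have sq : sqnorm (\prod_(z <- rs) ('X - (radial z)%:P)) <= (expR E)%:C%C.
  have := le_trans (schur_prod rs) flat.
  have -> : \prod_(z <- rs) `|z| = (\prod_(z <- rs) normc z)%:C%C.
    by rewrite rmorph_prod; apply: eq_bigr => z _; rewrite normr_normc.
  by rewrite rmorphM [_ * (\prod_(z <- rs) normc z)%:C%C]mulrC ler_pM2l // ltcR.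
rewrite -(big_map radial xpredT (fun w => w ^+ k)).
apply: le_trans (@power_sum_le _ _ (expR E) k k0 _ _) _.
- by move=> _ /mapP[z zrs ->]; apply: normc_radial; exact: (flat_neq0 flat zrs).
- move=> i; rewrite big_map.
  have := le_trans (sqnorm_coef _ i) sq; rewrite normr_normc -(rmorphXn (real_complex R)) lecR.
  move=> h; rewrite -(@ler_pXn2r _ 2) ?nnegrE ?expR_ge0 ?normc_ge0 //.
  apply: le_trans h _; rewrite expr2 ler_peMl ?expR_ge0 //.
  by rewrite -expR0 ler_expR.
rewrite ler_wpM2l ?mulr_ge0 ?exprn_ge0 // lnM ?posrE ?expR_gt0 // expRK lerD2r.
(* What remains is [ln 2 <= 1], that is [2 <= e]. *)
rewrite -[leRHS]expRK ler_ln ?posrE ?expR_gt0 //.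
by apply: le_trans (expR_ge1Dx _); lra.
Qed.

(** The constant coefficient averages to itself and the others multiply power sums. The constant [C]
    depends on [p] alone. *)
Lemma flat_average (p : {poly R[i]}) : exists2 C : R, 0 <= C &
  forall rs E, (0 < size rs)%N -> flat_roots rs E ->
  `| (\sum_(z <- rs) Re p.[radial z]) / (size rs)%:R - Re p`_0 | <= C * (1 + E) / (size rs)%:R.
Proof.
exists (\sum_(k < size p) normc p`_k * (k%:R * 2 ^+ k.+1)).
  by apply: sumr_ge0 => k _; rewrite mulr_ge0 ?normc_ge0 // mulr_ge0 // exprn_ge0.
move=> rs E s0 flat; have s0' : 0 < (size rs)%:R :> R by rewrite ltr0n.
have -> : Re p`_0 = (\sum_(z <- rs) Re p`_0) / (size rs)%:R.
  by rewrite big_const_seq count_predT iter_addr_0 -[Re _ *+ _]mulr_natr mulfK // gt_eqF.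
rewrite -mulrBl normrM normfV [X in _ / X]ger0_norm // ler_wpM2r ?invr_ge0 //.
rewrite -sumrB; under eq_bigr => z _ do rewrite -ReN -ReD.
rewrite -Re_sum; apply: le_trans (Re_le_normc _) _.
have -> : \sum_(z <- rs) (p.[radial z] - p`_0) =
    \sum_(k < size p) p`_k * (if k == 0%N :> nat then 0 else \sum_(z <- rs) radial z ^+ k).
  transitivity (\sum_(z <- rs) \sum_(k < size p)
      p`_k * (if k == 0%N :> nat then 0 else radial z ^+ k)).
    apply: eq_bigr => z _; rewrite horner_coef.
    case Es: (size p) => [|n].
      by rewrite !big_ord0 nth_default ?subr0 // Es.
    rewrite !big_ord_recl /= expr0 mulr1 mulr0 add0r addrAC subrr add0r.
    by apply: eq_bigr.
  rewrite exchange_big /=; apply: eq_bigr => k _; rewrite -mulr_sumr; case: ifP => // _.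
  by rewrite big1.
apply: le_trans (normc_sum _ _ _) _; rewrite mulr_suml; apply: ler_sum => k _.
rewrite normcM -mulrA ler_wpM2l ?normc_ge0 //; case: eqP => [->|/eqP k0].
  by rewrite normc0 mul0r mul0r.
by apply: flat_power_sum; rewrite // lt0n.
Qed.

(** [J] stands for the mean of [f] on the circle, known only through the third hypothesis. Roots are
    projected radially, [f] is replaced by [Re p], and [Re p] is averaged; projection, approximation
    and the comparison with [J] cost [e / 3] each, besides terms in [(1 + E) / size rs]. *)
Lemma equidistribution_bound (f : R[i] -> R) (M J : R) :
  (forall z, `|f z| <= M) ->
  (forall e, 0 < e -> exists2 d, 0 < d & forall w z, normc w = 1 ->
     normc (z - w) < d -> `|f z - f w| <= e) ->
  (forall e p, (forall w, normc w = 1 -> `|f w - Re p.[w]| <= e) -> `|J - Re p`_0| <= e) ->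
  forall e, 0 < e -> exists2 C : R, 0 <= C & forall rs E, (0 < size rs)%N -> flat_roots rs E ->
  `| (\sum_(z <- rs) f z) / (size rs)%:R - J | <= e + C * (1 + E) / (size rs)%:R.
Proof.
move=> fM fc fJ e e0; have e30 : 0 < e / 3 by rewrite divr_gt0.
have M0 : 0 <= M by apply: le_trans (fM 0).
have [p fp] : exists p : {poly R[i]}, forall w, normc w = 1 -> `|f w - Re p.[w]| <= e / 3.
  apply: (@circle_approx _ f M) => // e' /fc[d d0 h]; exists d => // w z _ z1 wz.
  exact: h.
have [C1 C10 hC1] := flat_average p.
have [d' d'0 fd'] := fc _ e30; pose d := Num.min d' 2^-1.
have d0 : 0 < d by rewrite lt_min d'0 invr_gt0 /=.
have d1 : d <= 2^-1 by rewrite ge_min lexx orbT.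
have dd' : d <= d' by rewrite ge_min lexx.
have lnp : 0 < ln (1 + d) by rewrite ln_gt0 //; lra.
have lnn : 0 < - ln (1 - d) by rewrite oppr_gt0 ln_lt0 //; apply/andP; split; lra.
(* The number of roots at distance at least [d] from the circle is at most [C2 * E]. *)
pose C2 := (ln (1 + d))^-1 + 2 / - ln (1 - d).
have C20 : 0 <= C2 by rewrite addr_ge0 ?divr_ge0 ?invr_ge0 ?ltW.
exists (2 * M * C2 + C1); first by rewrite addr_ge0 // mulr_ge0 // mulr_ge0.
move=> rs E s0 flat; have E0 := flat_ge0 flat.
have s0' : 0 < (size rs)%:R :> R by rewrite ltr0n.
have nz z : z \in rs -> z != 0 by move=> zrs; exact: (flat_neq0 flat zrs).
have far : `| (\sum_(z <- rs) f z) / (size rs)%:R - (\sum_(z <- rs) f (radial z)) / (size rs)%:R |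
    <= e / 3 + 2 * M * C2 * (1 + E) / (size rs)%:R.
  rewrite -mulrBl -sumrB normrM normfV [X in _ / X]ger0_norm // ler_pdivrMr // mulrDl divfK
    ?gt_eqF //.
  pose far1 z := 1 + d <= normc z; pose far2 z := normc z <= 1 - d.
  apply: le_trans (ler_norm_sum _ _ _) _.
  apply: (@le_trans _ _ (\sum_(z <- rs) (e / 3 + (2 * M * (far1 z)%:R + 2 * M * (far2 z)%:R)))).
    rewrite big_seq [leRHS]big_seq; apply: ler_sum => z zrs.
    have b2 : `|f z - f (radial z)| <= 2 * M.
      apply: le_trans (ler_normB _ _) _; have := fM z; have := fM (radial z); lra.
    rewrite /far1 /far2; case: (leP (1 + d)) => h1; case: (leP (normc z)) => h2;
      rewrite /= ?mulr1 ?mulr0; try lra.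
    rewrite !addr0; apply: fd'; first exact/normc_radial/nz.
    rewrite normc_sub_radial ?nz //; apply: lt_le_trans dd'.
    by rewrite ltr_norml; apply/andP; split; lra.
  rewrite big_split big_split /= big_const_seq count_predT iter_addr_0 -!mulr_sumr.
  rewrite -[e / 3 *+ _]mulr_natr lerD2l -mulrDr -!mulrA ler_wpM2l // ler_wpM2l //.
  have cnt (S : pred R[i]) : \sum_(z <- rs) (S z)%:R = (count S rs)%:R :> R.
    by rewrite -sum1_count -natr_sum [in RHS]big_mkcond /=; apply/congr1/eq_bigr => z _;
      case: (S z).
  rewrite !cnt.
  have := flat_count_out d0 flat; rewrite -ler_pdivlMr // => h1.
  have d11 : d < 1 by lra.
  have := flat_count_in d0 d11 flat; rewrite -ler_pdivlMr // => h2.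
  apply: le_trans (lerD h1 h2) _.
  have -> : E / ln (1 + d) + 2 * E / - ln (1 - d) = C2 * E by rewrite /C2; ring.
  by rewrite ler_wpM2l //; lra.
have mid : `| (\sum_(z <- rs) f (radial z)) / (size rs)%:R -
    (\sum_(z <- rs) Re p.[radial z]) / (size rs)%:R | <= e / 3.
  rewrite -mulrBl -sumrB normrM normfV [X in _ / X]ger0_norm // ler_pdivrMr //.
  apply: le_trans (ler_norm_sum _ _ _) _.
  apply: (@le_trans _ _ (\sum_(z <- rs) e / 3)).
    rewrite big_seq [leRHS]big_seq; apply: ler_sum => z zrs.
    exact/fp/normc_radial/nz.
  by rewrite big_const_seq count_predT iter_addr_0 mulr_natr.
have := hC1 _ _ s0 flat; have := fJ _ _ fp.
have -> : e + (2 * M * C2 + C1) * (1 + E) / (size rs)%:R =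
   e / 3 + 2 * M * C2 * (1 + E) / (size rs)%:R + e / 3 + C1 * (1 + E) / (size rs)%:R + e / 3.
  by field; rewrite gt_eqF.
move: far mid; set y1 := 2 * M * C2 * (1 + E) / _; set y2 := C1 * (1 + E) / _.
set x1 := (\sum_(z <- rs) f z) / _; set x2 := (\sum_(z <- rs) f (radial z)) / _.
set x3 := (\sum_(z <- rs) Re p.[radial z]) / _.
move=> t1 t2 t3 t4.
have -> : x1 - J = (x1 - x2) + (x2 - x3) + (x3 - Re p`_0) + - (J - Re p`_0) by ring.
apply: le_trans (ler_normD _ _) _; rewrite normrN.
have := ler_normD (x1 - x2 + (x2 - x3)) (x3 - Re p`_0).
have := ler_normD (x1 - x2) (x2 - x3).
lra.
Qed.

End EquidistributionBound.

(** * Continuous functions near the circle *)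

Section ContinuousOnC.
Variable R : realType.

Lemma continuous_measurable_borelC (f : R[i]^o -> R) : continuous f ->
  measurable_fun [set: borelC R] (f : borelC R -> R).
Proof.
move=> /continuousP cf; apply: (measurability _ (RGenOpens.measurableE R)).
move=> _ [_ [a [b ->] <-]]; rewrite setTI; apply: sub_sigma_algebra.
exact/cf/interval_open.
Qed.

Lemma expi_surj (w : R[i]) : normc w = 1 ->
  exists2 t : R, t \in `[- pi, pi]%R & expi t = w.
Proof.
move=> /(congr1 (fun x => x ^+ 2)); rewrite normc_sqr expr1n; case: w => a b /= ab.
have a1 : -1 <= a <= 1.
  by rewrite -ler_norml -(@ler_pXn2r _ 2) ?nnegrE // real_normK ?num_real // expr1n;
    have := sqr_ge0 b; lra.
have bE : `|b| = sin (acos a).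
  by rewrite sin_acos // -sqrtr_sqr; congr Num.sqrt; lra.
have p0 := acos_ge0 a1; have p1 := acos_lepi a1.
have aK : cos (acos a) = a by rewrite acosK // in_itv.
have [b0|b0] := leP 0 b.
  exists (acos a); first by rewrite in_itv /=; apply/andP; split; lra.
  by rewrite /expi aK -bE ger0_norm.
exists (- acos a); first by rewrite in_itv /=; apply/andP; split; lra.
by rewrite /expi cosN sinN aK -bE ltr0_norm // opprK.
Qed.

Lemma compact_circle : compact [set w : R[i]^o | normc w = 1].
Proof.
have -> : [set w : R[i]^o | normc w = 1] = (@expi R : R -> R[i]^o) @` `[- pi, pi].
  apply/seteqP; split => w /=; last first.
    by move=> [t _ <-]; rewrite /expi /= cos2Dsin2 sqrtr1.
  by move=> /expi_surj [t tpi <-]; exists t.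
apply: continuous_compact; last exact: segment_compact.
exact/continuous_subspaceT/continuous_expi.
Qed.

(** Only [w] is confined to the circle; [z] may leave it, as the roots do. Compactness is used as a
    near-covering, with [d] tending to 0 from the right. *)
Lemma circle_unif_continuous (f : R[i]^o -> R) : continuous f ->
  forall e, 0 < e -> exists2 d, 0 < d & forall w z, normc w = 1 ->
     normc (z - w) < d -> `|f z - f w| <= e.
Proof.
move=> cf e e0.
pose P (d : R) (w : R[i]^o) := forall z, normc (z - w) < d -> `|f z - f w| <= e.
have /compact_near_coveringP/(_ R (0 : R)^'+ P _) := compact_circle.
case=> [w _|d /= d0 h].
- have e20 : 0 < e / 2 by rewrite divr_gt0.
  have /cvgrPdist_lt/(_ _ e20)/nbhs_ballP[r /= r0 hr] := cf w.
  (* Radii of balls in [R[i]^o] are themselves complex; being positive, [r] is real. *)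
  have rE : r = (Re r)%:C%C by rewrite RRe_real // gtr0_real.
  have r0' : 0 < Re r by rewrite -ltcR -rE.
  exists (ball w (r / 2), [set d | d < Re r / 2]) => /=.
    split; first by apply: nbhsx_ballx; rewrite divr_gt0.
    by apply: nbhs_right_lt; rewrite divr_gt0.
  have half : r / 2 = (Re r / 2)%:C%C by rewrite {1}rE -[2 in LHS](rmorph_nat (real_complex R))
    -fmorphV -rmorphM.
  move=> [x d] /= [wx dr] z zx.
  have bwx : normc (w - x) < Re r / 2.
    by move: wx; rewrite /ball /= half normr_normc ltcR.
  have bw y : normc (w - y) < Re r -> `|f w - f y| < e / 2.
    by move=> wy; apply: hr; rewrite /ball /= rE normr_normc ltcR.
  have hx : `|f w - f x| < e / 2 by apply: bw; lra.
  have hz : `|f w - f z| < e / 2.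
    apply: bw; have -> : w - z = (w - x) + - (z - x) by ring.
    by apply: le_lt_trans (le_normcD _ _) _; rewrite normcN; lra.
  have -> : f z - f x = (f w - f x) - (f w - f z) by ring.
  apply: le_trans (ler_normB _ _) _; lra.
- exists (d / 2); first by rewrite divr_gt0.
  move=> w z w1; apply: (h (d / 2)) => //=; last by rewrite divr_gt0.
  by rewrite sub0r normrN gtr0_norm ?divr_gt0 // gtr_pMr // invf_lt1 // ltr1n.
Qed.

End ContinuousOnC.

(** * Integrals against finite measures and root measures *)

Section RintegralFinite.
Context d (T : measurableType d) (R : realType) (mu : {measure set T -> \bar R}).
Hypothesis mufin : (mu [set: T] < +oo)%E.

Lemma bounded_integrable (f : T -> R) (M : R) : measurable_fun [set: T] f ->
  (forall x, `|f x| <= M) -> mu.-integrable [set: T] (EFin \o f).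
Proof.
move=> mf fM; apply: measurable_bounded_integrable => //.
exists M; split; first exact: num_real.
by move=> x Mx y _; exact: le_trans (fM y) (ltW Mx).
Qed.

(** Reduces a bounded [f] to the nonnegative [f + M], to which the integral formulas for nonnegative
    functions apply. *)
Lemma Rintegral_shift (f : T -> R) (M : R) : measurable_fun [set: T] f ->
  (forall x, `|f x| <= M) ->
  \int[mu]_(x in [set: T]) f x =
  \int[mu]_(x in [set: T]) (f x + M) - \int[mu]_(x in [set: T]) M.
Proof.
move=> mf fM; rewrite -RintegralB //.
- by apply: eq_Rintegral => x _; rewrite addrK.
- apply: (@bounded_integrable _ (M + `|M|)); first exact: measurable_funD.
  by move=> x; rewrite (le_trans (ler_normD _ _)) // lerD.
- by apply: (@bounded_integrable _ `|M|).
Qed.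

End RintegralFinite.

Section RootMeasure.
Variables (R : realType) (p : {poly R[i]}).

Let d := size (roots_of p).

Lemma root_measure_fin : (root_measure p [set: borelC R] < +oo)%E.
Proof.
rewrite /root_measure /= /mscale /= /msum /=.
under eq_bigr => j _ do rewrite diracT.
by rewrite sumEFin -EFinM ltry.
Qed.

Lemma Rintegral_root_measure_ge0 (f : borelC R -> R) :
  measurable_fun [set: borelC R] f -> (forall x, 0 <= f x) ->
  \int[root_measure p]_(x in [set: borelC R]) f x = (\sum_(z <- roots_of p) f z) / d%:R.
Proof.
move=> mf f0; have mf' : measurable_fun [set: borelC R] (EFin \o f) by exact/measurable_EFinP.
rewrite /Rintegral ge0_integral_mscale //; last by move=> x _; rewrite lee_fin.
rewrite ge0_integral_measure_sum //; last by move=> x _; rewrite lee_fin.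
under eq_bigr => j _ do rewrite integral_dirac // diracT mul1e.
rewrite sumEFin -EFinM /= mulrC; congr (_ * _).
by rewrite (big_nth 0) big_mkord.
Qed.

Lemma Rintegral_root_measure (f : borelC R -> R) (M : R) :
  measurable_fun [set: borelC R] f -> (forall x, `|f x| <= M) ->
  \int[root_measure p]_(x in [set: borelC R]) f x = (\sum_(z <- roots_of p) f z) / d%:R.
Proof.
move=> mf fM; have M0 : 0 <= M by apply: le_trans (fM 0).
rewrite (Rintegral_shift root_measure_fin mf fM) !Rintegral_root_measure_ge0 //.
- rewrite -mulrBl -sumrB; congr (_ / _); apply: eq_bigr => z _.
  by rewrite addrK.
- exact: measurable_funD.
- by move=> x; have := fM x; rewrite ler_norml => /andP[+ _]; rewrite -lerBlDr sub0r.
Qed.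

End RootMeasure.

(** * Integration against the uniform measure on the circle *)

Section Haar.
Variable R : realType.
Local Notation U := (uniform_prob (lt0_2pi R)).

(** The fundamental theorem of calculus, applied to [g + M] and its antiderivative [G t + M t]. *)
Lemma Rintegral_uniform (g G : R -> R) (M : R) :
  (forall t, `|g t| <= M) -> continuous g -> (forall t : R, is_derive t 1 G (g t)) ->
  \int[U]_(t in [set: measurableTypeR R]) g t = (G (pi *+ 2) - G 0) / (pi *+ 2).
Proof.
move=> gM cg dG; have p0 := lt0_2pi R.
have mg : measurable_fun [set: measurableTypeR R] (g : measurableTypeR R -> R).
  exact: continuous_measurable_fun.
have Ufin : (U [set: measurableTypeR R] < +oo)%E by rewrite probability_setT ltry.
rewrite (Rintegral_shift Ufin mg gM) Rintegral_cst //.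
rewrite [X in fine X](@probability_setT _ _ _ U) mulr1.
have dG' (t : R) : is_derive t (1 : R) (fun t => G t + M * t) (g t + M).
  have h := is_deriveD (dG t) (is_deriveZ M (is_derive_id t (1 : R))).
  by apply: is_derive_eq; rewrite /= /GRing.scale /= mulr1.
have cG : continuous (fun t => G t + M * t).
  by move=> t; apply/differentiable_continuous/derivable1_diffP/(@ex_derive _ _ _ _ _ _ _ (dG' t)).
have -> : \int[U]_(t in [set: measurableTypeR R]) (g t + M) =
    ((G (pi *+ 2) + M * (pi *+ 2)) - (G 0 + M * 0)) / (pi *+ 2).
  rewrite /Rintegral integral_uniform; last 2 first.
  - by apply/measurable_EFinP; apply: measurable_funD.
  - move=> t; rewrite lee_fin; have := gM t; rewrite ler_norml => /andP[+ _].
    by rewrite -lerBlDr sub0r.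
  rewrite (@continuous_FTC2 _ (fun t => g t + M) (fun t => G t + M * t)) //.
  - by rewrite -EFinB -EFinM /= subr0 mulrC.
  - by apply/continuous_subspaceT => t; apply: cvgD; [exact: cg|exact: cvg_cst].
  - split; first by move=> t _; exact: (@ex_derive _ _ _ _ _ _ _ (dG' t)).
      by apply: cvg_at_right_filter; exact: cG.
    by apply: cvg_at_left_filter; exact: cG.
  - by move=> t _; rewrite derive1E; apply: derive_val.
have aux (a x y : R) : 0 < a -> (x + M * a - (y + M * 0)) / a - M = (x - y) / a.
  by move=> a0; field; rewrite gt_eqF.
exact: aux.
Qed.

Lemma expiX (t : R) k : (expi t : R[i]) ^+ k = (cos (k%:R * t) +i* sin (k%:R * t))%C.
Proof.
elim: k => [|k IH]; first by rewrite mul0r cos0 sin0.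
rewrite exprS IH -natr1 mulrDl mul1r cosD sinD /expi.
by apply/eqP; rewrite eq_complex /=; apply/andP; split; apply/eqP; ring.
Qed.

Lemma sin_2pi_nat k : sin (k%:R * (pi *+ 2)) = 0 :> R.
Proof.
by rewrite mulr_natl -[X in sin X]add0r (periodicn (@sinD2pi R)) sin0.
Qed.

Lemma cos_2pi_nat k : cos (k%:R * (pi *+ 2)) = 1 :> R.
Proof.
by rewrite mulr_natl -[X in cos X]add0r (periodicn (@cosD2pi R)) cos0.
Qed.

Definition trig_term (p : {poly R[i]}) (k : nat) (t : R) : R :=
  Re p`_k * cos (k%:R * t) - complex.Im p`_k * sin (k%:R * t).

Lemma Re_horner_expi p t :
  Re p.[expi t : R[i]] = \sum_(k < size p) trig_term p k t.
Proof.
rewrite horner_coef Re_sum; apply: eq_bigr => k _; rewrite expiX /trig_term.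
by case: (p`_k).
Qed.

Lemma Re_horner_expi_le p t :
  `|Re p.[expi t : R[i]]| <= \sum_(k < size p) normc p`_k.
Proof.
apply: le_trans (Re_le_normc _) _; rewrite horner_coef.
apply: le_trans (normc_sum _ _ _) _; apply: ler_sum => k _.
by rewrite normcM normcX /expi /= cos2Dsin2 sqrtr1 expr1n mulr1.
Qed.

Let is_derive_linear (k : nat) (t : R) : is_derive t (1 : R) (fun t => k%:R * t) k%:R.
Proof.
have := is_deriveZ k%:R (is_derive_id t (1 : R)).
by rewrite /GRing.scale /= mulr1.
Qed.

Let is_derive_cos_nat (k : nat) (t : R) :
  is_derive t (1 : R) (fun t => cos (k%:R * t)) (- sin (k%:R * t) * k%:R).
Proof.
exact: (@is_derive1_comp R (@cos R) (fun t => k%:R * t) t _ _ (is_derive_cos _)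
  (is_derive_linear k t)).
Qed.

Let is_derive_sin_nat (k : nat) (t : R) :
  is_derive t (1 : R) (fun t => sin (k%:R * t)) (cos (k%:R * t) * k%:R).
Proof.
exact: (@is_derive1_comp R (@sin R) (fun t => k%:R * t) t _ _ (is_derive_sin _)
  (is_derive_linear k t)).
Qed.

Lemma continuous_trig_term p k : continuous (trig_term p k).
Proof.
move=> t.
have cc : {for t, continuous (fun t : R => cos (k%:R * t))}.
  by apply/differentiable_continuous/derivable1_diffP/(@ex_derive _ _ _ _ _ _ _
    (is_derive_cos_nat k t)).
have cs : {for t, continuous (fun t : R => sin (k%:R * t))}.
  by apply/differentiable_continuous/derivable1_diffP/(@ex_derive _ _ _ _ _ _ _
    (is_derive_sin_nat k t)).
by apply: cvgB; apply: cvgMl_tmp; [exact: cc|exact: cs].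
Qed.

Lemma continuous_Re_horner_expi p : continuous (fun t : R => Re p.[expi t : R[i]]).
Proof.
have -> : (fun t : R => Re p.[expi t : R[i]]) = (fun t => \sum_(k < size p) trig_term p k t).
  by apply/funext => t; rewrite Re_horner_expi.
apply: (@continuous_big R _ +%R 0 xpredT (@add_continuous R^o)) => k _.
exact: continuous_trig_term.
Qed.

(** The mean value property: the antiderivatives of terms of positive frequency agree at [0] and
    [2 pi]. *)
Lemma Rintegral_uniform_poly (p : {poly R[i]}) :
  \int[U]_(t in [set: measurableTypeR R]) Re p.[expi t : R[i]] = Re p`_0.
Proof.
pose H (k : nat) (t : R) : R :=
  if k == 0%N then Re p`_k * t
  else k%:R^-1 * (Re p`_k * sin (k%:R * t) + complex.Im p`_k * cos (k%:R * t)).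
have dH k (t : R) : is_derive t (1 : R) (H k) (trig_term p k t).
  rewrite /H /trig_term; case: eqP => [->|/eqP k0].
    rewrite mul0r cos0 sin0 mulr0 mulr1 subr0.
    have := is_deriveZ (Re p`_0) (is_derive_id t (1 : R)).
    by rewrite /GRing.scale /= mulr1.
  have h1 := is_deriveZ (Re p`_k) (is_derive_sin_nat k t).
  have h2 := is_deriveZ (complex.Im p`_k) (is_derive_cos_nat k t).
  have h3 := is_deriveZ k%:R^-1 (is_deriveD h1 h2).
  apply: (is_derive_eq h3); rewrite /GRing.scale /=; field.
  by rewrite pnatr_eq0.
have dG (t : R) : is_derive t (1 : R) (fun t => \sum_(k < size p) H k t) (Re p.[expi t : R[i]]).
  rewrite Re_horner_expi; have := is_derive_sum (fun k : 'I_(size p) => dH k t).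
  by have -> : \sum_(k < size p) H k = (fun t => \sum_(k < size p) H k t)
    by apply/funext => s; rewrite fct_sumE.
rewrite (Rintegral_uniform (@Re_horner_expi_le p) (@continuous_Re_horner_expi p) dG) -sumrB.
have p0 : pi *+ 2 != 0 :> R by rewrite gt_eqF // lt0_2pi.
rewrite /H; case Es: (size p) => [|n].
  by rewrite big_ord0 mul0r nth_default // Es.
rewrite big_ord_recl /= big1 => [|k _]; first by rewrite mulr0 subr0 addr0 mulfK.
by rewrite sin_2pi_nat cos_2pi_nat !mulr0 sin0 cos0 mulr0 subrr.
Qed.

(** Supplies the third hypothesis of [equidistribution_bound]; integrating against a probability
    does not enlarge a uniform error. *)
Lemma haar_circle_poly (f : R[i]^o -> R) (M e : R) (p : {poly R[i]}) :
  continuous f -> (forall z, `|f z| <= M) ->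
  (forall w, normc w = 1 -> `|f w - Re p.[w]| <= e) ->
  `|\int[haar_circle R]_(z in [set: borelC R]) f z - Re p`_0| <= e.
Proof.
move=> cf fM fp.
have mf := continuous_measurable_borelC cf.
have mexpi : measurable_fun [set: measurableTypeR R] (@expi R) by exact: measurable_expi.
have Ufin : (U [set: measurableTypeR R] < +oo)%E by rewrite probability_setT ltry.
have mfe : measurable_fun [set: measurableTypeR R] ((f : borelC R -> R) \o @expi R).
  exact: measurableT_comp.
have ife := bounded_integrable Ufin mfe (fun t => fM (expi t)).
have -> : \int[haar_circle R]_(z in [set: borelC R]) f z =
    \int[U]_(t in [set: measurableTypeR R]) f (expi t).
  rewrite /Rintegral /haar_circle integral_distribution //.
  exact/measurable_EFinP.
have mp : measurable_fun [set: measurableTypeR R]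
    (fun t : measurableTypeR R => Re p.[expi t : R[i]]).
  by apply: continuous_measurable_fun; exact: continuous_Re_horner_expi.
have ip := bounded_integrable Ufin mp (@Re_horner_expi_le p).
have iB : (U : {measure set _ -> \bar R}).-integrable [set: measurableTypeR R]
    (EFin \o (fun t : measurableTypeR R => f (expi t) - Re p.[expi t : R[i]])).
  apply: (@bounded_integrable _ _ _ _ Ufin _ (M + \sum_(k < size p) normc p`_k)).
    exact: measurable_funB.
  by move=> t; rewrite (le_trans (ler_normB _ _)) // lerD // Re_horner_expi_le.
rewrite -Rintegral_uniform_poly -RintegralB //.
apply: le_trans (le_normr_Rintegral measurableT iB) _.
have ie : (U : {measure set _ -> \bar R}).-integrable [set: measurableTypeR R] (EFin \o cst e).
  by apply: (@bounded_integrable _ _ _ _ Ufin _ `|e|).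
apply: le_trans (@le_Rintegral _ _ _ _ _ _ (cst e) _ _ ie _) _ => //.
- exact: integrable_norm.
- by move=> t _; apply: fp; rewrite /expi /= cos2Dsin2 sqrtr1.
by rewrite Rintegral_cst // [X in fine X](@probability_setT _ _ _ U) mulr1.
Qed.

End Haar.

(** * Upper bound for the number of unimodal sequences *)

Section CountUnimodal.
Variables (T n : nat).
Hypothesis nTT : (n < T * T)%N.
Local Open Scope nat_scope.

(* As [n < T^2], a partition of at most [n] has fewer than [T] parts that are
   at least [T]; these are listed, and the smaller parts are counted. *)
Definition parts_code (s : seq nat) : T.-tuple 'I_n.+1 * T.-tuple 'I_n.+1 :=
  ([tuple inord (count_mem (i : nat) s) | i < T],
   [tuple inord (nth 0 [seq x <- s | T <= x] i) | i < T]).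

Lemma leq_sumn_mem (s : seq nat) x : x \in s -> x <= sumn s.
Proof.
elim: s => //= y s IH; rewrite inE => /orP[/eqP ->|/IH]; first exact: leq_addr.
by move=> h; exact: leq_trans h (leq_addl _ _).
Qed.

Lemma size_leq_sumn (s : seq nat) : all (leq 1) s -> size s <= sumn s.
Proof. by elim: s => //= y s IH /andP[y1 /IH h]; rewrite -add1n leq_add. Qed.

(** With [r] such parts, [T * r <= sumn s <= n < T * T]. *)
Lemma size_big_parts (s : seq nat) : sumn s <= n -> size [seq x <- s | T <= x] < T.
Proof.
move=> sn; rewrite -(ltn_pmul2l (m := T)); last by case: (T) nTT.
apply: leq_ltn_trans nTT; apply: leq_trans sn.
elim: s => [|x s IH] /=; first by rewrite muln0.
case: (leqP T x) => /= h; first by rewrite mulnS leq_add.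
exact: leq_trans IH (leq_addl _ _).
Qed.

(** Every encoded entry is at most [n], so [inord] loses nothing. The list of large parts is padded
    with zeros, which cannot be large parts since [T > 0]; its length is thus recovered. *)
Lemma parts_code_perm (s s' : seq nat) :
  all (leq 1) s -> all (leq 1) s' -> sumn s <= n -> sumn s' <= n ->
  parts_code s = parts_code s' -> perm_eq s s'.
Proof.
move=> s1 s1' sn sn' e.
have e1 i := congr1 (fun c => val (tnth c.1 i)) e.
have e2 i := congr1 (fun c => val (tnth c.2 i)) e.
have T0 : 0 < T by case: (T) nTT.
have small v : v < T -> count_mem v s = count_mem v s'.
  move=> vT; have := e1 (Ordinal vT).
  rewrite /= !tnth_mktuple /= !inordK //; rewrite ltnS.
    exact: leq_trans (count_size _ _) (leq_trans (size_leq_sumn s1') sn').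
  exact: leq_trans (count_size _ _) (leq_trans (size_leq_sumn s1) sn).
have nth_le (r : seq nat) i : sumn r <= n -> nth 0 [seq x <- r | T <= x] i < n.+1.
  move=> rn; rewrite ltnS; case: (ltnP i (size [seq x <- r | T <= x])) => h;
    last by rewrite nth_default.
  by have := mem_nth 0 h; rewrite mem_filter => /andP[_ /leq_sumn_mem h']; exact: leq_trans h' rn.
have big i : i < T -> nth 0 [seq x <- s | T <= x] i = nth 0 [seq x <- s' | T <= x] i.
  move=> vT; have := e2 (Ordinal vT).
  by rewrite /= !tnth_mktuple /= !inordK // nth_le.
have size_le (r r' : seq nat) : sumn r <= n ->
    (forall i, i < T -> nth 0 [seq x <- r | T <= x] i = nth 0 [seq x <- r' | T <= x] i) ->
    size [seq x <- r' | T <= x] <= size [seq x <- r | T <= x].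
  move=> rn h; rewrite leqNgt; apply/negP => lt.
  have := h _ (size_big_parts rn); rewrite nth_default // => e0.
  by have := mem_nth 0 lt; rewrite -e0 mem_filter leqn0 => /andP[/eqP T00]; rewrite T00 in T0.
have eqF : [seq x <- s | T <= x] = [seq x <- s' | T <= x].
  apply: (@eq_from_nth _ 0).
    by apply/eqP; rewrite eqn_leq !size_le // => i iT; rewrite big.
  by move=> i h; apply: big; exact: ltn_trans h (size_big_parts sn).
have cntF v (r : seq nat) : T <= v -> count_mem v r = count_mem v [seq x <- r | T <= x].
  move=> Tv; rewrite count_filter; apply: eq_count => x /=.
  by case: eqP => [->|].
rewrite /perm_eq; apply/allP => v _ /=; case: (ltnP v T) => h; first by rewrite small.
by rewrite cntF // eqF -cntF.
Qed.

Definition unimodal_code (a : seq nat) (k : nat) :=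
  (parts_code (take k a), (inord (nth 0 a k) : 'I_n.+1), parts_code (drop k.+1 a)).

(** Each side of the peak is sorted, hence determined by its multiset of parts, and the length of
    the left side is the index of the peak. *)
Lemma unimodal_code_inj a a' k k' : unimodal a k -> unimodal a' k' ->
  sumn a = n -> sumn a' = n ->
  unimodal_code a k = unimodal_code a' k' -> a = a' /\ k = k'.
Proof.
move=> /and4P[ka a1 sa da] /and4P[ka' a1' sa' da'] an an' e.
have e1 := congr1 (fun c => c.1.1) e; have e2 := congr1 (fun c => val c.1.2) e.
have e3 := congr1 snd e.
have split (b : seq nat) j : j < size b -> b = take j b ++ nth 0 b j :: drop j.+1 b.
  by move=> jb; rewrite -drop_nth // cat_take_drop.
have parts (b : seq nat) j : j < size b -> all (leq 1) b -> sumn b = n ->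
  [/\ all (leq 1) (take j b), all (leq 1) (drop j.+1 b), sumn (take j b) <= n,
      sumn (drop j.+1 b) <= n & nth 0 b j <= n].
  move=> jb b1 bn; have := bn; rewrite {1}(split _ _ jb) sumn_cat /= => bn'.
  move: b1; rewrite {1}(split _ _ jb) all_cat /= => /and3P[h1 h2 h3].
  by split => //; rewrite -bn'; lia.
have [p1 p2 p3 p4 p5] := parts _ _ ka a1 an.
have [p1' p2' p3' p4' p5'] := parts _ _ ka' a1' an'.
have sl (b : seq nat) j : j < size b -> sorted leq (take j.+1 b) -> sorted leq (take j b).
  by move=> jb h; have := take_sorted j h; rewrite take_takel.
have sg (b : seq nat) j : j < size b -> sorted geq (drop j b) -> sorted geq (drop j.+1 b).
  by move=> jb; rewrite (drop_nth 0 jb) /=; exact: path_sorted.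
have t_eq : take k a = take k' a'.
  apply: (sorted_eq leq_trans anti_leq); [exact: sl | exact: sl |].
  exact: parts_code_perm.
have d_eq : drop k.+1 a = drop k'.+1 a'.
  apply: (sorted_eq (leT := geq)); [| | exact: sg | exact: sg |].
  - by move=> x y z xy yz; exact: leq_trans yz xy.
  - by move=> x y h; apply: anti_leq; rewrite andbC.
  exact: parts_code_perm.
have n_eq : nth 0 a k = nth 0 a' k'.
  by move: e2; rewrite /= !inordK.
split; first by rewrite (split _ _ ka) t_eq n_eq d_eq -split.
by have := congr1 size t_eq; rewrite !size_take ka ka'.
Qed.

(** A code has four blocks of length [T] and a peak; the sum over the lengths costs one more factor
    [n.+1]. *)
Lemma u_le m : u m n <= n.+1 ^ (4 * T + 2).
Proof.
pose K : finType := ((T.-tuple 'I_n.+1 * T.-tuple 'I_n.+1) * 'I_n.+1 *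
   (T.-tuple 'I_n.+1 * T.-tuple 'I_n.+1))%type.
have cardK : #|K| = n.+1 ^ (4 * T + 1).
  rewrite !card_prod !card_tuple !card_ord -!expnD -expnSr -expnD; congr (_ ^ _); lia.
rewrite /u; apply: (@leq_trans (\sum_(s < n.+1) #|K|)); last first.
  rewrite sum_nat_const card_ord cardK -expnS; apply: leq_pexp2l => //; lia.
apply: leq_sum => s _.
pose f (x : s.-tuple 'I_n.+1 * 'I_s) : K := unimodal_code (map val x.1) x.2.
apply: (@leq_card_in _ _ f) => x y.
rewrite !inE => /and3P[ux /eqP sx _] /and3P[uy /eqP sy _] exy.
have [h1 h2] := unimodal_code_inj ux uy sx sy exy.
case: x y h1 h2 {ux sx uy sy exy} => [x1 x2] [y1 y2] /= h1 h2; congr (_, _).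
  by apply: val_inj; exact: (inj_map val_inj).
exact: val_inj.
Qed.

End CountUnimodal.

(** * Sequences witnessing that the extreme coefficients are nonzero *)

Section CountUnimodalLower.
Local Open Scope nat_scope.

Lemma u_gt0 m n (a : seq nat) k : unimodal a k -> sumn a = n ->
  unimodal_rank a k = m -> 0 < u m n.
Proof.
move=> ua an ram; have [sa aa] := unimodal_bounded ua an.
have ka : k < size a by case/and4P: ua.
have sP : size a < n.+1 by rewrite ltnS.
have mapK : map val [seq (inord x : 'I_n.+1) | x <- a] = a.
  rewrite -map_comp -[RHS]map_id; apply/eq_in_map => x /(allP aa) xn /=.
  by rewrite inordK.
have szP : size [seq (inord x : 'I_n.+1) | x <- a] == size a by rewrite size_map.
rewrite /u (bigD1 (Ordinal sP)) //= addn_gt0; apply/orP; left.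
apply/card_gt0P; exists (Tuple szP, Ordinal ka).
by rewrite inE /= mapK ua an ram !eqxx.
Qed.

Lemma u_rank0_gt0 n : 0 < n -> 0 < u 0 n.
Proof.
move=> n0; apply: (@u_gt0 _ _ [:: n] 0) => //; last by rewrite /= addn0.
by rewrite /unimodal /= n0.
Qed.

Lemma u_rank_max_gt0 n : 0 < u n%:Z n.+1.
Proof.
apply: (@u_gt0 _ _ (nseq n.+1 1) 0); last 2 first.
- by rewrite sumn_nseq mul1n.
- by rewrite /unimodal_rank /= drop0 size_nseq subr0.
rewrite /unimodal size_nseq /= all_nseq /= orbT /=; elim: n => //= n.
by case: n.
Qed.

End CountUnimodalLower.

(** * The Erdos-Turan condition for [Q] *)

Section RootsOfQ.
Variable R : realType.
Implicit Types n : nat.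

Lemma coef_Q n k : (@Q R n)`_k =
  if k == 0%N then 2^-1 * (u 0 n)%:R
  else if (k < n)%N then (u k%:Z n)%:R else 0.
Proof.
rewrite /Q coefD coefC coef_sum; case: eqP => [->|/eqP k0].
  rewrite big_nat big1 ?addr0 // => m /andP[m0 _].
  by rewrite coefZ coefXn eq_sym (negPf (lt0n_neq0 m0)) mulr0.
rewrite add0r; under eq_bigr => m _ do rewrite coefZ coefXn.
case: ltnP => kn.
  rewrite (big_rem k) /=; last by rewrite mem_index_iota lt0n k0.
  rewrite eqxx mulr1 big_seq big1 ?addr0 // => m.
  rewrite mem_rem_uniq ?iota_uniq // inE => /andP[mk _].
  by rewrite eq_sym (negPf mk) mulr0.
rewrite big_nat big1 // => m /andP[_ mn].
by rewrite gtn_eqF ?mulr0 // (leq_trans mn).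
Qed.

Lemma size_Q n : (1 < n)%N -> size (@Q R n) = n.
Proof.
case: n => [|[|n]] // _; apply/eqP; rewrite eqn_leq; apply/andP; split.
  apply/leq_sizeP => j nj; rewrite coef_Q ltnNge nj /=.
  by case: eqP nj => // ->.
rewrite ltnNge; apply/negP => /leq_sizeP/(_ _ (leqnn _)).
rewrite coef_Q /= ltnSn => /eqP; rewrite pnatr_eq0 => /eqP h.
by have := u_rank_max_gt0 n.+1; rewrite h.
Qed.

Lemma normc_nat (k : nat) : normc (k%:R : R[i]) = k%:R.
Proof. by rewrite -(rmorph_nat (real_complex R)) normc_real ger0_norm. Qed.

(** The least [T] with [n < T * T], as [u_le] requires. *)
Definition part_cutoff n : nat := (Num.truncn (Num.sqrt n%:R : R)).+1.

Lemma part_cutoff_sqr n : (n < part_cutoff n * part_cutoff n)%N.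
Proof.
rewrite -(ltr_nat R) natrM -[X in X < _](@sqr_sqrtr R n%:R) // expr2.
by apply: ltr_pM; rewrite ?sqrtr_ge0 // /part_cutoff truncnS_gt.
Qed.

Lemma part_cutoff_le n : (part_cutoff n)%:R <= Num.sqrt n%:R + 1 :> R.
Proof. by rewrite /part_cutoff -natr1 lerD2r truncn_le ?sqrtr_ge0. Qed.

(** The logarithm of [(n+1)^(8 T + 6)], which dominates [2 n W^2] when [W] is the bound of
    [u_le]. *)
Definition height_exponent n : R := (8 * part_cutoff n + 6)%:R * ln (n.+1)%:R.

Lemma normc_coef_Q_le n k : normc (@Q R n)`_k <= (n.+1 ^ (4 * part_cutoff n + 2))%:R.
Proof.
have ule m : (u m n)%:R <= (n.+1 ^ (4 * part_cutoff n + 2))%:R :> R.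
  by rewrite ler_nat u_le // part_cutoff_sqr.
rewrite coef_Q; case: eqP => _.
  rewrite normcM normcV !normc_nat.
  apply: le_trans (ule 0); rewrite mulrC ler_pdivrMr // ler_peMr //.
  by rewrite ler1n.
by case: ltnP => _; rewrite ?normc_nat ?ule // normc0 ler0n.
Qed.

(** The monic polynomial has [n] coefficients of modulus at most [W / L], [L] being the leading
    coefficient of [Q]. As [L >= 1] and [L * p0 >= 1/2], one has [L^-2 <= L^-1 <= 2 * p0]. *)
Lemma flat_roots_Q n : (1 < n)%N -> flat_roots (roots_of (@Q R n)) (height_exponent n).
Proof.
move=> n1; rewrite /roots_of; case: closed_field_poly_normal => rs /= Qrs.
set l := lead_coef (Q R n) in Qrs.
have n0 : (0 < n)%N by exact: ltnW.
set W : R := (n.+1 ^ (4 * part_cutoff n + 2))%:R.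
have lE : l = (u n.-1%:Z n)%:R.
  rewrite /l lead_coefE size_Q // coef_Q prednK // leqnn.
  by case: n n1 {n0 Qrs l W} => [|[|n]].
have u1 : (1 <= u n.-1%:Z n)%N by have := u_rank_max_gt0 n.-1; rewrite prednK.
set L : R := (u n.-1%:Z n)%:R.
have L1 : 1 <= L by rewrite ler1n.
have lL : normc l = L by rewrite lE normc_nat.
set P := \prod_(z <- rs) ('X - z%:P) in Qrs *.
set p0 := \prod_(z <- rs) normc z.
have P0 : normc P`_0 = p0.
  rewrite -horner_coef0 horner_prod normc_prod; apply: eq_bigr => z _.
  by rewrite hornerXsubC sub0r normcN.
(* [L * p0] is the constant coefficient [u 0 n / 2] of [Q]. *)
have Lp0 : 2^-1 <= L * p0.
  rewrite -P0 -lL -normcM -coefZ -Qrs coef_Q eqxx normcM normcV !normc_nat.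
  by rewrite ler_peMr ?invr_ge0 // ler1n u_rank0_gt0.
have sizeP : size P = n.
  have := size_Q n1; rewrite Qrs size_scale //.
  by rewrite -normc_eq0 lL gt_eqF // (lt_le_trans _ L1).
have Pk k : normc P`_k <= W / L.
  rewrite ler_pdivlMr ?(lt_le_trans _ L1) // mulrC -lL -normcM -coefZ -Qrs.
  exact: normc_coef_Q_le.
have sq : sqnorm P <= (n%:R * (W / L) ^+ 2)%:C%C.
  rewrite /sqnorm sizeP.
  have -> : \sum_(i < n) `|P`_i| ^+ 2 = (\sum_(i < n) normc P`_i ^+ 2)%:C%C.
    by rewrite rmorph_sum; apply: eq_bigr => i _; rewrite normr_normc rmorphXn.
  rewrite lecR -[n in n%:R]card_ord -sumr_const mulr_suml.
  apply: ler_sum => i _; rewrite mul1r; apply: lerXn2r; rewrite ?nnegrE ?normc_ge0 //.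
  by apply: le_trans (Pk 0%N); exact: normc_ge0.
apply: le_trans sq _; rewrite lecR.
have W0 : 0 <= W by exact: ler0n.
have Ege : 2 * n%:R * W ^+ 2 <= expR (height_exponent n).
  rewrite /height_exponent [in leRHS]mulrC expRM_natr lnK ?posrE ?ltr0n // /W -!natrX -!natrM
    ler_nat.
  (* The exponent splits into [W^2] and [(n+1)^2], the latter absorbing [2 n]. *)
  have -> : (8 * part_cutoff n + 6 = 2 + (4 * part_cutoff n + 2) * 2)%N by lia.
  rewrite [leqRHS]expnD [X in (_ <= _ * X)%N]expnM leq_mul2r; apply/orP; right.
  by rewrite expnS expn1; clear; nia.
apply: (@le_trans _ _ (2 * n%:R * W ^+ 2 * p0)); last first.
  by rewrite ler_wpM2r // prodr_ge0 // => z _; exact: normc_ge0.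
have L0 : 0 < L by exact: lt_le_trans L1.
have -> : n%:R * (W / L) ^+ 2 = n%:R * W ^+ 2 * L^-1 ^+ 2 by ring.
have -> : 2 * n%:R * W ^+ 2 * p0 = n%:R * W ^+ 2 * (2 * p0) by ring.
rewrite ler_wpM2l ?mulr_ge0 ?exprn_ge0 //.
apply: (@le_trans _ _ L^-1).
  by rewrite expr2 ger_pMl ?invr_gt0 // invf_le1.
by rewrite -[X in X <= _]mul1r ler_pdivrMr //; lra.
Qed.

(** In terms of [y = (n+1)^(1/4)], [ln (n+1) <= 4 y] and [8 T + 6 <= 22 y^2], so the numerator is at
    most [89 y^3]. As [y^4 <= 4 (n-1)], the constant is [4 * 89 = 356]. *)
Lemma height_exponent_le n : (1 < n)%N ->
  (1 + height_exponent n) / n.-1%:R <= 356 / Num.sqrt (Num.sqrt n.+1%:R).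
Proof.
move=> n1; set y := Num.sqrt (Num.sqrt n.+1%:R).
have y2 : y ^+ 2 = Num.sqrt n.+1%:R by rewrite sqr_sqrtr ?sqrtr_ge0.
have y4 : y ^+ 4 = n.+1%:R by rewrite (exprM y 2 2) y2 sqr_sqrtr.
have y1 : 1 <= y.
  by rewrite -(@ler_pXn2r _ 4) ?nnegrE ?sqrtr_ge0 // expr1n y4 ler1n.
have y0 : 0 < y by exact: lt_le_trans y1.
have lny : ln n.+1%:R <= 4 * y.
  rewrite -y4 lnXn // -[ln y *+ _]mulr_natl ler_wpM2l //.
  by apply: ltW; exact: ln_sublinear.
have ln0 : 0 <= ln n.+1%:R :> R by rewrite ln_ge0 // ler1n.
have T8 : (8 * part_cutoff n + 6)%:R <= 8 * y ^+ 2 + 14 :> R.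
  have := part_cutoff_le n; have : Num.sqrt n%:R <= y ^+ 2.
    by rewrite y2 ler_sqrt // ler_nat.
  by rewrite natrD natrM; lra.
have yy : 1 <= y ^+ 2 by rewrite exprn_ege1.
have yyy : 1 <= y ^+ 3 by rewrite exprn_ege1.
have Ey : 1 + height_exponent n <= 89 * y ^+ 3.
  have : height_exponent n <= (22 * y ^+ 2) * (4 * y).
    by rewrite /height_exponent; apply: ler_pM => //; lra.
  have -> : 22 * y ^+ 2 * (4 * y) = 88 * y ^+ 3 by ring.
  lra.
have n0 : 0 < n.-1%:R :> R by rewrite ltr0n -ltnS prednK // ltnW.
have ny : y ^+ 4 <= 4 * n.-1%:R.
  by rewrite y4 -natrM ler_nat; clear -n1; lia.
rewrite ler_pdivrMr // mulrAC ler_pdivlMr //.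
apply: (@le_trans _ _ (89 * y ^+ 3 * y)); first by rewrite ler_wpM2r // ltW.
have -> : 89 * y ^+ 3 * y = 89 * y ^+ 4 by ring.
lra.
Qed.

End RootsOfQ.

(** * Equidistribution of the roots of [Q] *)

Theorem theorem4p4 (R : realType) : roots_equidistribute (@Q R).
Proof.
move=> f cf [M fM].
set J := (\int[_]_(x in _) _ : R).
have hJ e p : (forall w, normc w = 1 -> `|f w - Re p.[w]| <= e) -> `|J - Re p`_0| <= e.
  exact: haar_circle_poly fM.
apply/cvgrPdist_le => e e0; have e20 : 0 < e / 2 by rewrite divr_gt0.
have [C C0 hC] := equidistribution_bound fM (circle_unif_continuous cf) hJ e20.
(* As [712 = 2 * 356], the error [C * (356 / y)] is at most [e / 2] once [y >= B], which [n >= B^4]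
   ensures. *)
pose B : R := 712 * C / e.
have B0 : 0 <= B by exact: divr_ge0 (mulr_ge0 (ler0n _ _) C0) (ltW e0).
near=> n.
have n1 : (1 < n)%N by near: n; exact: nbhs_infty_gt.
have nB : B ^+ 4 <= n%:R by near: n; exact: nbhs_infty_ger.
have sz : size (roots_of (@Q R n)) = n.-1.
  have := size_Q R n1; rewrite /roots_of; case: closed_field_poly_normal => rs /= {1}->.
  rewrite size_scale ?size_prod_XsubC => [<- //|].
  by rewrite lead_coef_eq0 -size_poly_gt0 size_Q // ltnW.
have n10 : (0 < n.-1)%N by rewrite -ltnS prednK // ltnW.
have := hC (roots_of (@Q R n)) (height_exponent R n); rewrite sz => /(_ n10 (flat_roots_Q R n1)).
rewrite (Rintegral_root_measure (@Q R n) (continuous_measurable_borelC cf) fM) sz distrC.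
move=> h; apply: le_trans h _; rewrite -mulrA.
set y : R := Num.sqrt (Num.sqrt n.+1%:R).
have By : B <= y.
  rewrite -(@ler_pXn2r _ 4) ?nnegrE ?sqrtr_ge0 //.
  rewrite (exprM y 2 2) !sqr_sqrtr ?sqrtr_ge0 //.
  by apply: le_trans nB _; rewrite ler_nat.
have y0 : 0 < y by rewrite !sqrtr_gt0 ltr0n.
have := ler_wpM2l C0 (height_exponent_le R n1).
have : C * (356 / y) <= e / 2.
  rewrite mulrA ler_pdivrMr //; move: By; rewrite ler_pdivrMr //; lra.
lra.
Unshelve. all: by end_near.
Qed.
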